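(* Assume that $H$ is coercive, i.e. $\lim_{|p|\to\infty}\min_{x\in\mathbb T^n}H_i(x,p)=\infty$ for every $i\in\mathbb I$; that $B(x)$ is a monotone matrix for every $x\in\mathbb T^n$; and that the system $Bu+H[u]=0$ in $\mathbb T^n$ has a solution $v_0\in\operatorname{Lip}(\mathbb T^n)^m$. For $\lambda>0$ let $v^\lambda=(v^\lambda_i)_{i\in\mathbb I}$ be the unique solution of $\lambda v^\lambda+Bv^\lambda+H[v^\lambda]=0$ in $\mathbb T^n$. Then there exists a solution $v^0=(v^0_i)_{i\in\mathbb I}\in\operatorname{Lip}(\mathbb T^n)^m$ of $Bv^0+H[v^0]=0$ in $\mathbb T^n$ such that, for all $i\in\mathbb I$, the functions $v_i^\lambda$ converge to $v_i^0$ uniformly on $\mathbb T^n$ as $\lambda\to0+$.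
   Context: Let $m,n\in\mathbb N$, $\mathbb I=\{1,\dots,m\}$, let $\mathbb T^n$ be the $n$-dimensional flat torus, $\Xi$ a (nonempty) compact metric space, $g=(g_i)_{i\in\mathbb I}\in C(\mathbb T^n\times\Xi,\mathbb R^n)^m$ and $L=(L_i)_{i\in\mathbb I}\in C(\mathbb T^n\times\Xi)^m$. The Hamiltonian $H=(H_i)_{i\in\mathbb I}$ is given by $H_i(x,p)=\max_{\xi\in\Xi}[-g_i(x,\xi)\cdot p-L_i(x,\xi)]$ for $(x,p)\in\mathbb T^n\times\mathbb R^n$. Let $B=(b_{ij})_{i,j\in\mathbb I}\in C(\mathbb T^n)^{m\times m}$, acting on $u\in C(\mathbb T^n)^m$ by $(Bu)_i(x)=\sum_{j\in\mathbb I}b_{ij}(x)u_j(x)$. The notation $H[u]$ stands for $(H_i(x,Du_i(x)))_{i\in\mathbb I}$. Monotone matrix: a real $m\times m$ matrix $A$ is monotone if whenever $u\in\mathbb R^m$ and $u_k=\max_{i\in\mathbb I}u_i\ge0$, then $(Au)_k\ge0$. Solutions are viscosity solutions: for $\lambda\ge0$, $u\in C(\mathbb T^n)^m$ is a subsolution (resp. supersolution) of $\lambda u+Bu+H[u]=0$ in $\mathbb T^n$ if for every $i\in\mathbb I$, $\psi\in C^1(\mathbb T^n)$ and every maximum (resp. minimum) point $x$ of $u_i-\psi$, one has $\lambda u_i(x)+(Bu)_i(x)+H_i(x,D\psi(x))\le0$ (resp. $\ge0$); a solution is both. It is known that under coercivity of $H$ and monotonicity of $B$, for each $\lambda>0$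 the system has a unique solution $v^\lambda$, and $v^\lambda\in\operatorname{Lip}(\mathbb T^n)^m$. $\operatorname{Lip}(\mathbb T^n)$ is the set of Lipschitz continuous real functions on $\mathbb T^n$. *)

(* Defs.v *)
From HB Require Import structures.
From mathcomp Require Import all_boot all_order all_algebra.
From mathcomp Require Import all_classical all_reals all_analysis.
From mathcomp Require Import ring.

Set Implicit Arguments.
Unset Strict Implicit.
Unset Printing Implicit Defensive.

Import Order.TTheory GRing.Theory Num.Theory.
Import numFieldNormedType.Exports.

Local Open Scope classical_set_scope.
Local Open Scope ring_scope.

(* The flat torus is R^n / Z^n: functions on it are represented by the
   Z^n-periodic functions on R^n, which identifies continuous, C^1 and Lipschitz
   functions on the torus with the periodic functions of the same regularity,
   and extrema (resp. uniform convergence) over the torus with those over R^n.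
   R^n is 'rV[R]_n, normed by the library with the max norm; the notions below
   depend on the norm only up to equivalence. *)
Definition Zperiodic (R : realType) (n : nat) (T : Type) (f : 'rV[R]_n -> T) :=
  forall (z : 'rV[int]_n) (x : 'rV[R]_n), f (x + map_mx intr z) = f x.

Definition torus_continuous (R : realType) (n : nat) (f : 'rV[R]_n -> R) :=
  Zperiodic f /\ continuous f.

Definition torus_lipschitz (R : realType) (n : nat) (f : 'rV[R]_n -> R) :=
  Zperiodic f /\ lipschitz f.

Definition grad (R : realType) (n : nat) (f : 'rV[R]_n -> R) (x : 'rV[R]_n)
    : 'rV[R]_n :=
  \row_k 'D_(delta_mx 0 k) f x.

Definition torus_C1 (R : realType) (n : nat) (f : 'rV[R]_n -> R) :=
  [/\ Zperiodic f, (forall x, differentiable f x) & continuous (grad f)].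

Definition dot (R : realType) (n : nat) (p q : 'rV[R]_n) : R :=
  \sum_k p 0 k * q 0 k.

(* For continuous data on a nonempty compact Xi, the supremum is a maximum:
   see hamiltonian_is_max. *)
Definition hamiltonian (R : realType) (m n : nat) (Xi : Type)
    (g : 'I_m -> 'rV[R]_n -> Xi -> 'rV[R]_n) (L : 'I_m -> 'rV[R]_n -> Xi -> R)
    (i : 'I_m) (x p : 'rV[R]_n) : R :=
  sup (range (fun xi => - dot (g i x xi) p - L i x xi)).

Lemma hamiltonian_is_max (R : realType) (m n : nat) (Xi : topologicalType)
    (g : 'I_m -> 'rV[R]_n -> Xi -> 'rV[R]_n) (L : 'I_m -> 'rV[R]_n -> Xi -> R)
    (i : 'I_m) (x p : 'rV[R]_n) :
  [set: Xi] !=set0 -> compact [set: Xi] ->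
  continuous (fun z : 'rV[R]_n * Xi => g i z.1 z.2) ->
  continuous (fun z : 'rV[R]_n * Xi => L i z.1 z.2) ->
  (exists xi, hamiltonian g L i x p = - dot (g i x xi) p - L i x xi) /\
  (forall xi, - dot (g i x xi) p - L i x xi <= hamiltonian g L i x p).
Proof.
move=> Xi0 cXi cg cL.
pose F (xi : Xi) := - dot (g i x xi) p - L i x xi.
have cpair : continuous (fun xi : Xi => (x, xi)).
  by move=> xi; apply: (@cvg_pair _ _ _ _ (nbhs x) (nbhs xi)); [exact: cvg_cst|exact: cvg_id].
have cgx : continuous (fun xi => g i x xi).
  by move=> xi; apply: (@continuous_comp _ _ _ (fun xi => (x, xi)) (fun z => g i z.1 z.2)); [exact: cpair|exact: cg].
have cLx : continuous (fun xi => L i x xi).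
  by move=> xi; apply: (@continuous_comp _ _ _ (fun xi => (x, xi)) (fun z => L i z.1 z.2)); [exact: cpair|exact: cL].
have cF : continuous F.
  move=> xi; apply: cvgB; last exact: cLx.
  apply: cvgN; rewrite /dot; apply: cvg_big => [|k _]; first exact: add_continuous.
  apply: cvgM; last exact: cvg_cst.
  apply: (@continuous_comp _ _ _ (fun xi => g i x xi) (fun v : 'rV[R]_n => v 0 k)).
    exact: cgx.
  exact: coord_continuous.
have [c _ Fc] := compact_EVT_max Xi0 cXi (continuous_subspaceT cF).
have Hc : hamiltonian g L i x p = F c.
  apply/eqP; rewrite eq_le; apply/andP; split.
    apply: ge_sup; first by exists (F c), c.
    by move=> _ [xi _ <-]; apply: Fc; rewrite inE.
  apply: ub_le_sup; last by exists c.
  by exists (F c) => _ [xi _ <-]; apply: Fc; rewrite inE.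
by split; [exists c | move=> xi; rewrite Hc; apply: Fc; rewrite inE].
Qed.

Definition at_norm_infty (R : realType) (n : nat) : set_system 'rV[R]_n :=
  filter_from [set: R] (fun r => [set p | r < `|p|]).

(* The infimum over x is a minimum over the torus when H is continuous and
   periodic in x: see hamiltonian_has_min. *)
Definition coercive (R : realType) (m n : nat)
    (H : 'I_m -> 'rV[R]_n -> 'rV[R]_n -> R) :=
  forall i, inf (range (fun x => H i x p)) @[p --> @at_norm_infty R n] --> +oo.

Lemma hamiltonian_continuous_l (R : realType) (m n : nat) (Xi : topologicalType)
    (g : 'I_m -> 'rV[R]_n -> Xi -> 'rV[R]_n) (L : 'I_m -> 'rV[R]_n -> Xi -> R)
    (i : 'I_m) (p : 'rV[R]_n) :
  [set: Xi] !=set0 -> compact [set: Xi] ->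
  continuous (fun z : 'rV[R]_n * Xi => g i z.1 z.2) ->
  continuous (fun z : 'rV[R]_n * Xi => L i z.1 z.2) ->
  continuous (fun x => hamiltonian g L i x p).
Proof.
move=> Xi0 cXi cg cL x.
pose F (y : 'rV[R]_n) (xi : Xi) := - dot (g i y xi) p - L i y xi.
have cF : continuous (fun z : 'rV[R]_n * Xi => F z.1 z.2).
  move=> z; apply: cvgB; last exact: cL.
  apply: cvgN; rewrite /dot; apply: cvg_big => [|k _]; first exact: add_continuous.
  apply: cvgM; last exact: cvg_cst.
  apply: (@continuous_comp _ _ _ (fun z => g i z.1 z.2) (fun v : 'rV[R]_n => v 0 k)).
    exact: cg.
  exact: coord_continuous.
have Hmax y := hamiltonian_is_max y p Xi0 cXi cg cL.
have Fx : Filter (nbhs x) := nbhs_filter x.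
apply/cvgrPdist_le => e e0.
have unif : \forall y \near x, [set: Xi] `<=` (fun xi => `|F x xi - F y xi| <= e).
  apply: ((compact_near_coveringP [set: Xi]).1 cXi 'rV[R]_n (nbhs x)
    (fun y xi => `|F x xi - F y xi| <= e)).
  move=> xi _.
  have e20 : 0 < e / 2 by rewrite divr_gt0.
  have /cvgrPdist_le/(_ _ e20) near1 := cF (x, xi).
  case: near1 => -[/= U V] [xU xiV] UV.
  exists (V, U) => // -[/= xi' y] [Vxi' Uy].
  have h1 := UV (y, xi') (conj Uy Vxi').
  have h2 := UV (x, xi') (conj (nbhs_singleton xU) Vxi').
  rewrite -(subrKC (F x xi) (F x xi' - F y xi')) /=.
  rewrite (_ : F x xi + _ = (F x xi - F y xi') - (F x xi - F x xi')); last first.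
    by rewrite !opprB !addrA; ring.
  by rewrite [e]splitr (le_trans (ler_normB _ _))// lerD.
apply: filterS unif => y unif_.
have {}unif xi : `|F x xi - F y xi| <= e by exact: unif_.
rewrite ler_distl; apply/andP; split.
  have [[xi Hy] _] := Hmax y; have [_ /(_ xi) Hx] := Hmax x.
  rewrite Hy lerBlDr (le_trans _ (lerD Hx (lexx e)))//.
  have := unif xi; rewrite ler_distl => /andP[+ _].
  by rewrite lerBlDr.
have [[xi Hx] _] := Hmax x; have [_ /(_ xi) Hy] := Hmax y.
rewrite Hx (le_trans _ (lerD Hy (lexx e)))//.
by have := unif xi; rewrite ler_distl => /andP[_ +].
Qed.

Lemma hamiltonian_has_min (R : realType) (m n : nat) (Xi : topologicalType)
    (g : 'I_m -> 'rV[R]_n -> Xi -> 'rV[R]_n) (L : 'I_m -> 'rV[R]_n -> Xi -> R)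
    (i : 'I_m) (p : 'rV[R]_n) :
  [set: Xi] !=set0 -> compact [set: Xi] ->
  Zperiodic (g i) -> Zperiodic (L i) ->
  continuous (fun z : 'rV[R]_n * Xi => g i z.1 z.2) ->
  continuous (fun z : 'rV[R]_n * Xi => L i z.1 z.2) ->
  (exists x, inf (range (fun y => hamiltonian g L i y p)) =
             hamiltonian g L i x p) /\
  (forall x, inf (range (fun y => hamiltonian g L i y p)) <=
             hamiltonian g L i x p).
Proof.
move=> Xi0 cXi pg pL cg cL.
pose h y := hamiltonian g L i y p.
have ch : continuous h by exact: hamiltonian_continuous_l.
have ph : Zperiodic h.
  by move=> z y; rewrite /h /hamiltonian pg pL.
have cube_compact : compact [set v : 'rV[R]_n | forall k, `[0, 1]%classic (v ord0 k)].
  apply: (@rV_compact R n (fun=> [set` `[0 : R, 1]])) => _.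
  exact: segment_compact.
have cube0 : [set v : 'rV[R]_n | forall k, `[0, 1]%classic (v ord0 k)] !=set0.
  by exists 0 => k; rewrite /= mxE in_itv/= lexx ler01.
have [c _ hc] := compact_EVT_min cube0 cube_compact (continuous_subspaceT ch).
have {}hc y : h c <= h y.
  pose z : 'rV[int]_n := \row_k - Num.floor (y 0 k).
  rewrite -(ph z y); apply: hc; rewrite inE => k /=.
  rewrite !mxE in_itv/= mulrNz subr_ge0 lerBlDr floor_le//=.
  by rewrite addrC -[1]/(1%:~R) -intrD ltW// floorD1_gt.
have Hc : inf (range h) = h c.
  apply/eqP; rewrite eq_le; apply/andP; split.
    by apply: ge_inf; [exists (h c) => _ [y _ <-]|exists c].
  by apply: lb_le_inf; [exists (h c), c|move=> _ [y _ <-]].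
by split; [exists c | move=> x; rewrite Hc; exact: hc].
Qed.

Definition monotone_matrix (R : realType) (m : nat) (A : 'M[R]_m) :=
  forall (u : 'cV[R]_m) (k : 'I_m),
    (forall i, u i 0 <= u k 0) -> 0 <= u k 0 -> 0 <= (A *m u) k 0.

Definition apply_coupling (R : realType) (m n : nat) (B : 'rV[R]_n -> 'M[R]_m)
    (u : 'I_m -> 'rV[R]_n -> R) (i : 'I_m) (x : 'rV[R]_n) : R :=
  \sum_j B x i j * u j x.

Definition is_subsolution (R : realType) (m n : nat) (lam : R)
    (B : 'rV[R]_n -> 'M[R]_m) (H : 'I_m -> 'rV[R]_n -> 'rV[R]_n -> R)
    (u : 'I_m -> 'rV[R]_n -> R) :=
  (forall i, torus_continuous (u i)) /\
  forall (i : 'I_m) (psi : 'rV[R]_n -> R) (x : 'rV[R]_n), torus_C1 psi ->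
    (forall y, u i y - psi y <= u i x - psi x) ->
    lam * u i x + apply_coupling B u i x + H i x (grad psi x) <= 0.

Definition is_supersolution (R : realType) (m n : nat) (lam : R)
    (B : 'rV[R]_n -> 'M[R]_m) (H : 'I_m -> 'rV[R]_n -> 'rV[R]_n -> R)
    (u : 'I_m -> 'rV[R]_n -> R) :=
  (forall i, torus_continuous (u i)) /\
  forall (i : 'I_m) (psi : 'rV[R]_n -> R) (x : 'rV[R]_n), torus_C1 psi ->
    (forall y, u i x - psi x <= u i y - psi y) ->
    0 <= lam * u i x + apply_coupling B u i x + H i x (grad psi x).

Definition is_solution (R : realType) (m n : nat) (lam : R)
    (B : 'rV[R]_n -> 'M[R]_m) (H : 'I_m -> 'rV[R]_n -> 'rV[R]_n -> R)
    (u : 'I_m -> 'rV[R]_n -> R) :=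
  is_subsolution lam B H u /\ is_supersolution lam B H u.

(* Main.v *)
Require Import Defs.
From HB Require Import structures.
From mathcomp Require Import all_boot all_order all_algebra.
From mathcomp Require Import all_classical all_reals all_analysis.
From mathcomp Require Import ring lra.

Set Implicit Arguments.
Unset Strict Implicit.
Unset Printing Implicit Defensive.

Import Order.TTheory GRing.Theory Num.Theory.
Import numFieldNormedType.Exports.

Local Open Scope classical_set_scope.
Local Open Scope ring_scope.

(** The idea is that an undiscounted subsolution, once it lies below one
    discounted solution up to a constant, stays below all solutions with a
    smaller discount up to the same constant ([subsolution_le_propagates]). If
    [B w + H[w] <= 0] and [w <= v mu + d], then for [lam < mu] and
    [t = lam / mu] the function [psi = (1 - t) * w + t * v mu] satisfies, by
    convexity of the Hamiltonian, [B psi + H[psi] <= - lam * v mu], and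
    [v mu >= psi - (1 - t) * d]. Since constants [d >= 0] are sent to nonnegative
    vectors by a monotone matrix, [psi - (1 - t) * d] is a subsolution for the
    discount [lam], so [v lam >= psi - (1 - t) * d >= w - d].

    Any uniform limit [w] of [v lam] along some ultrafilter at [0^'+] is such a
    subsolution ([viscosity_stability]), and it is below some [v mu] up to an
    arbitrarily small [d]; hence [w] is below [v lam] up to [d] for all small
    [lam], and below any other limit ([ultrafilter_limit_le]). So all ultrafilter
    limits coincide, and they exist: comparison with the given undiscounted
    solution bounds [v lam] ([solution_bound]), coercivity then bounds the test
    gradients and so makes the family equi-Lipschitz
    ([lipschitz_of_gradient_bound]), and [equilipschitz_ultra_limit] supplies
    the limits.

    All comparisons come from one doubling argument with three variables,
    [convex_comparison], which treats a convex combination of two subsolutions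
    directly. Since test functions live on the torus, the quadratic penalty is
    replaced by the periodic function [gap]. *)

(** * A periodic substitute for the squared distance *)

Section trigonometry.
Variable R : realType.

Lemma cosDint (a : R) (z : int) : cos (a + z%:~R * (pi *+ 2)) = cos a.
Proof.
case: z => k; first by rewrite -[_%:~R]/(k%:R) mulr_natl (periodicn (@cosD2pi R)).
rewrite NegzE mulrNz mulNr -[_%:~R]/(k.+1%:R) mulr_natl.
by rewrite -[in RHS](subrK (pi *+ 2 *+ k.+1) a) (periodicn (@cosD2pi R)).
Qed.

Lemma cos_eq1_int (s : R) :
  cos (s * (pi *+ 2)) = 1 -> exists z : int, s = z%:~R.
Proof.
move=> cs1; exists (Num.floor s); set z := Num.floor s.
have /andP[zs sz] : z%:~R <= s < z%:~R + 1.
  by rewrite floor_le -[1]/(1%:~R) -intrD floorD1_gt.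
pose r := s - z%:~R.
have r0 : 0 <= r by rewrite subr_ge0.
have r1 : r < 1 by rewrite ltrBlDl.
have : cos (r * (pi *+ 2)) = 1.
  by rewrite /r mulrBl -mulNr -intrN cosDint.
have -> : r * (pi *+ 2) = (r * pi) *+ 2 by rewrite mulrnAr.
rewrite cos_mulr2n => h0.
have sp : sin (r * pi) ^+ 2 = 1 - cos (r * pi) ^+ 2.
  by rewrite -[X in X - _](cos2Dsin2 (r * pi)) addrC addKr.
have {h0} : sin (r * pi) ^+ 2 = 0 by rewrite sp; lra.
move/eqP; rewrite expf_eq0 /= => /eqP sr0.
apply/eqP; rewrite -subr_eq0 -/r; apply/negPn/negP => rn0.
have : 0 < sin (r * pi).
  have r_gt0 : 0 < r by rewrite lt_def rn0.
  apply: sin_gt0_pi; rewrite mulr_gt0 ?pi_gt0//=.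
  by rewrite -[ltRHS]mul1r ltr_pM2r ?pi_gt0.
by rewrite sr0 ltxx.
Qed.

Lemma norm_sin_le (x : R) : `|sin x| <= `|x|.
Proof.
have pos (y : R) : 0 < y -> `|sin y| <= `|y|.
  move=> y0.
  have [|c _] := @MVT R sin cos 0 y y0 (fun z _ => is_derive_sin z).
    by apply: continuous_subspaceT; exact: continuous_sin.
  rewrite sin0 !subr0 => ->; rewrite normrM ler_piMl//.
  by rewrite ler_norml cos_geN1 cos_le1.
have [x0|x0|->] := ltgtP x 0; last by rewrite sin0.
  by rewrite -normrN -sinN -(normrN x); apply: pos; rewrite oppr_gt0.
exact: pos.
Qed.

Lemma le_1Bcos_sqr (s : R) : 1 - cos s <= s ^+ 2.
Proof.
have -> : s = (s / 2) *+ 2 by rewrite -mulr_natr divfK// pnatr_eq0.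
set x := s / 2.
have sx : sin x ^+ 2 <= x ^+ 2.
  by rewrite -[leLHS]real_normK ?num_real// -[leRHS]real_normK ?num_real//
    ler_sqr ?nnegrE// norm_sin_le.
have x20 : 0 <= x ^+ 2 := sqr_ge0 x.
have := cos2Dsin2 x; rewrite cos_mulr2n => cs.
by rewrite -(mulr_natr x 2) exprMn; lra.
Qed.

End trigonometry.

Section test_functions.
Variables (R : realType) (n : nat).
Implicit Types (f h : 'rV[R]_n -> R) (x y c : 'rV[R]_n).

Lemma norm_coord_le x k : `|x 0 k| <= `|x|.
Proof.
by rewrite [leRHS]/Num.norm /= mx_normrE; apply/bigmax_geP; right => /=; exists (0, k).
Qed.

Lemma gradD f h x : differentiable f x -> differentiable h x ->
  grad (fun y => f y + h y) x = grad f x + grad h x.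
Proof.
move=> df dh; apply/rowP => k; rewrite !mxE -[fun y => _]/(f + h).
by rewrite deriveD//; exact: diff_derivable.
Qed.

Lemma gradZ a f x : differentiable f x ->
  grad (fun y => a * f y) x = a *: grad f x.
Proof.
move=> df; apply/rowP => k; rewrite !mxE -[fun y => _]/(a *: f).
by rewrite deriveZ//; exact: diff_derivable.
Qed.

Lemma grad_periodic f : Zperiodic f -> Zperiodic (grad f).
Proof.
move=> pf z x; apply/rowP => k; rewrite !mxE /derive.
apply: (congr1 (fun q : R -> R => lim (q @ 0^'))); apply/funext => r /=.
by rewrite pf addrA pf.
Qed.

Lemma torus_C1D f h : torus_C1 f -> torus_C1 h -> torus_C1 (fun y => f y + h y).
Proof.
move=> [pf df cf] [ph dh ch]; split.
- by move=> z x; rewrite pf ph.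
- by move=> x; apply: differentiableD.
- rewrite (_ : grad _ = fun y => grad f y + grad h y); last first.
    by apply/funext => x; rewrite gradD.
  by move=> x; exact: (cvgD (cf x) (ch x)).
Qed.

Lemma torus_C1Z a f : torus_C1 f -> torus_C1 (fun y => a * f y).
Proof.
move=> [pf df cf]; split.
- by move=> z x; rewrite pf.
- by move=> x; apply: differentiableZ.
- rewrite (_ : grad _ = fun y => a *: grad f y); last first.
    by apply/funext => x; rewrite gradZ.
  by move=> x; exact: (cvgZ (cvg_cst a) (cf x)).
Qed.

(** Any penalty used in a viscosity test has to be periodic and of class C^1.
    This one vanishes exactly when [y - c] is an integer vector and is
    comparable with the square of the distance to the lattice near its zeros, so
    it replaces the usual [`|y - c| ^+ 2]. *)
Definition gap c y : R := \sum_k (1 - cos ((y 0 k - c 0 k) * (pi *+ 2))).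

Lemma gap_ge0 c y : 0 <= gap c y.
Proof. by apply: sumr_ge0 => k _; rewrite subr_ge0 cos_le1. Qed.

Lemma gapC c y : gap c y = gap y c.
Proof. by apply: eq_bigr => k _; rewrite -[in RHS]cosN -mulNr opprB. Qed.

Lemma gapxx c : gap c c = 0.
Proof. by apply: big1 => k _; rewrite subrr mul0r cos0 subrr. Qed.

Lemma gap_periodic c : Zperiodic (gap c).
Proof.
move=> z y; apply: eq_bigr => k _; rewrite !mxE.
by rewrite addrAC mulrDl cosDint.
Qed.

Lemma gap_eq0 c y : gap c y = 0 -> exists z : 'rV[int]_n, y = c + map_mx intr z.
Proof.
move=> g0.
have cy k : exists z : int, y 0 k - c 0 k = z%:~R.
  apply: cos_eq1_int; apply/esym/eqP; rewrite -subr_eq0; apply/eqP.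
  move: g0 => /eqP; rewrite psumr_eq0; last first.
    by move=> i _; rewrite subr_ge0 cos_le1.
  by move=> /allP/(_ k); rewrite mem_index_enum => /(_ isT)/implyP/(_ isT)/eqP.
have [z zE] := choice cy.
exists (\row_k z k); apply/rowP => k.
by rewrite !mxE -zE subrKC.
Qed.

Lemma gap_le c y : gap c y <= n%:R * (`|y - c| * (pi *+ 2)) ^+ 2.
Proof.
rewrite -[n in n%:R]card_ord mulr_natl -sumr_const; apply: ler_sum => k _.
rewrite (le_trans (le_1Bcos_sqr _))// -real_normK ?num_real//.
have p0 : 0 <= pi *+ 2 :> R by rewrite mulrn_wge0// pi_ge0.
rewrite lerXn2r// ?nnegrE// ?mulr_ge0// normrM (ger0_norm p0) ler_wpM2r//.
have -> : y 0 k - c 0 k = (y - c) 0 k by rewrite !mxE.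
exact: norm_coord_le.
Qed.

Lemma gap_continuous : continuous (fun z : 'rV[R]_n * 'rV[R]_n => gap z.1 z.2).
Proof.
move=> z; rewrite /gap; apply: cvg_big => [|k _]; first exact: add_continuous.
apply: cvgB; first exact: cvg_cst.
apply: continuous_cvg; first exact: continuous_cos.
apply: cvgM; last exact: cvg_cst.
apply: cvgB.
  apply: (@continuous_comp _ _ _ snd (fun x : 'rV[R]_n => x 0 k)).
    exact: cvg_snd.
  exact: coord_continuous.
apply: (@continuous_comp _ _ _ fst (fun x : 'rV[R]_n => x 0 k)).
  exact: cvg_fst.
exact: coord_continuous.
Qed.

Let phase c k y : R := (y 0 k - c 0 k) * (pi *+ 2).

Let differentiable_phase c k y : differentiable (phase c k) y.
Proof.
have -> : phase c k = (pi *+ 2) *: ((fun x : 'rV[R]_n => x 0 k : R) - cst (c 0 k)).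
  by apply/funext => x; rewrite /phase mulrC.
apply: differentiableZ; apply: differentiableB => //.
exact: differentiable_coord.
Qed.

Let derive_phase c k y v : 'D_v (phase c k) y = v 0 k * (pi *+ 2).
Proof.
have dc : differentiable (fun x : 'rV[R]_n => x 0 k : R) y.
  exact: differentiable_coord.
have -> : phase c k = (pi *+ 2) *: ((fun x : 'rV[R]_n => x 0 k : R) - cst (c 0 k)).
  by apply/funext => x; rewrite /phase mulrC.
rewrite deriveZ; last by apply: diff_derivable; exact: differentiableB.
rewrite deriveB//; last exact: diff_derivable.
rewrite derive_cst subr0 mulrC; congr (_ * _).
have @f : {linear 'rV[R]_n -> R}.
  by exists (fun N : 'rV[R]_n => N 0 k); do 2![eexists]; do ?[constructor];
     rewrite ?mxE// => ? *; rewrite ?mxE//; move=> ?; rewrite !mxE.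
rewrite deriveE// -[fun x : 'rV[R]_n => _]/(f : 'rV[R]_n -> R) diff_lin//.
exact: coord_continuous.
Qed.

Let differentiable_mode c k y : differentiable (fun x => 1 - cos (phase c k x)) y.
Proof.
apply: differentiableB => //.
apply: differentiable_comp; first exact: differentiable_phase.
by apply/derivable1_diffP.
Qed.

Let derive_mode c k y v :
  'D_v (fun x => 1 - cos (phase c k x)) y = v 0 k * (pi *+ 2) * sin (phase c k y).
Proof.
have dcos a : differentiable (@cos R) a by apply/derivable1_diffP.
have dcp : differentiable (cos \o phase c k) y by exact: differentiable_comp.
rewrite -[fun x => _]/(cst 1 - (cos \o phase c k)) deriveB//; last exact: diff_derivable.
rewrite derive_cst sub0r deriveE// diff_comp//= -[X in 'd cos _ X]deriveE// derive_phase.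
rewrite deriv1E// derive1E derive_val /= /GRing.scale /=; ring.
Qed.

Let gapE c : gap c = \sum_k (fun x => 1 - cos (phase c k x)).
Proof. by apply/funext => y; rewrite /gap fct_sumE. Qed.

Lemma grad_gap c y k :
  grad (gap c) y 0 k = (pi *+ 2) * sin ((y 0 k - c 0 k) * (pi *+ 2)).
Proof.
rewrite mxE gapE derive_sum; last by move=> i; exact: diff_derivable.
rewrite (bigD1 k)//= big1 ?addr0 => [|i ik]; rewrite derive_mode mxE eqxx/=.
  by rewrite eqxx mul1r.
by rewrite (negPf ik) !mul0r.
Qed.

Lemma gap_C1 c : torus_C1 (gap c).
Proof.
split; first exact: gap_periodic.
- by move=> y; rewrite gapE; apply: differentiable_sum => k.
- have -> : grad (gap c) =
      fun y => \row_k ((pi *+ 2) * sin ((y 0 k - c 0 k) * (pi *+ 2))).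
    by apply/funext => y; apply/rowP => k; rewrite grad_gap mxE.
  have -> : (fun y : 'rV[R]_n => \row_k ((pi *+ 2) * sin ((y 0 k - c 0 k) * (pi *+ 2)))) =
      fun y => \sum_k ((pi *+ 2) * sin ((y 0 k - c 0 k) * (pi *+ 2))) *: delta_mx 0 k.
    apply/funext => y; rewrite [LHS]row_sum_delta.
    by apply: eq_bigr => k _; rewrite mxE.
  move=> y; have Fy : Filter (nbhs y) := nbhs_filter y.
  apply: cvg_big => [|k _]; first exact: add_continuous.
  apply: cvgZ; last exact: cvg_cst.
  apply: cvgM; first exact: cvg_cst.
  apply: continuous_cvg; first exact: continuous_sin.
  apply: cvgM; last exact: cvg_cst.
  by apply: cvgB; [exact: coord_continuous|exact: cvg_cst].
Qed.

Lemma gap_differentiable c y : differentiable (gap c) y.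
Proof. by case: (gap_C1 c) => _ + _; exact. Qed.

(** This antisymmetry is what makes the test gradients at the two ends of a
    doubled variable coincide. *)
Lemma grad_gapC c y : grad (gap c) y = - grad (gap y) c.
Proof.
by apply/rowP => k; rewrite [RHS]mxE !grad_gap -mulrN -sinN -mulNr opprB.
Qed.

Lemma grad_gapxx c : grad (gap c) c = 0.
Proof. by apply/rowP => k; rewrite grad_gap subrr mul0r sin0 mulr0 mxE. Qed.

(** Away from the cut locus the gradient of the penalty dominates its square
    root, as for a squared distance: each mode [1 - cos a] in [0, 1] satisfies
    [sin a ^+ 2 = (1 - cos a) * (1 + cos a) >= 1 - cos a]. The bound on the gap
    is what excludes the points where the sines vanish again. *)
Lemma gap_le_grad c y : gap c y <= 1 ->
  (pi *+ 2) ^+ 2 * gap c y <= \sum_k (grad (gap c) y 0 k) ^+ 2.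
Proof.
move=> g1; rewrite {1}/gap mulr_sumr; apply: ler_sum => k _; rewrite grad_gap exprMn.
rewrite ler_wpM2l ?sqr_ge0//.
set a := _ * (pi *+ 2).
have ca : 1 - cos a <= 1.
  apply: le_trans g1; rewrite /gap (bigD1 k)//= lerDl; apply: sumr_ge0 => i _.
  by rewrite subr_ge0 cos_le1.
have := cos2Dsin2 a; have := cos_le1 a; nra.
Qed.

End test_functions.

(** * Compactness of the torus *)

Lemma continuous_pair (T U V : topologicalType) (f : T -> U) (g : T -> V) :
  continuous f -> continuous g -> continuous (fun w => (f w, g w)).
Proof.
move=> cf cg w.
apply: (@cvg_pair _ _ _ _ (nbhs (f w)) (nbhs (g w))); [exact: cf|exact: cg].
Qed.

Lemma continuous_fst (U V : topologicalType) : continuous (@fst U V).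
Proof. by move=> w; exact: cvg_fst. Qed.

Lemma continuous_snd (U V : topologicalType) : continuous (@snd U V).
Proof. by move=> w; exact: cvg_snd. Qed.

Lemma continuous_compT (T U V : topologicalType) (f : T -> U) (g : U -> V) :
  continuous f -> continuous g -> continuous (fun w => g (f w)).
Proof. by move=> cf cg w; apply: continuous_comp; [exact: cf|exact: cg]. Qed.

Section torus_compactness.
Variables (R : realType) (n : nat).
Implicit Types (x y z : 'rV[R]_n).

Definition cube : set 'rV[R]_n := [set x | forall k, `[0, 1]%classic (x ord0 k)].

Lemma cube_compact : compact cube.
Proof.
apply: (@rV_compact R n (fun=> [set` `[0 : R, 1]])) => _.
exact: segment_compact.
Qed.

Lemma cube_neq0 : cube !=set0.
Proof. by exists 0 => k; rewrite /= mxE in_itv/= lexx ler01. Qed.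

Lemma cube_repr x : exists z : 'rV[int]_n, cube (x + map_mx intr z).
Proof.
exists (\row_k - Num.floor (x 0 k)) => k /=.
rewrite !mxE in_itv/= mulrNz subr_ge0 lerBlDr floor_le//=.
by rewrite addrC -[1]/(1%:~R) -intrD ltW// floorD1_gt.
Qed.

Lemma torus_max (f : 'rV[R]_n -> R) : torus_continuous f ->
  exists x, forall y, f y <= f x.
Proof.
move=> [pf cf].
have [c _ fc] := compact_EVT_max cube_neq0 cube_compact (continuous_subspaceT cf).
exists c => y; have [z zy] := cube_repr y.
by rewrite -(pf z y); apply: fc; rewrite inE.
Qed.

Lemma torus_bounded (f : 'rV[R]_n -> R) : torus_continuous f ->
  exists M, forall y, `|f y| <= M.
Proof.
move=> [pf cf].
have [|c cM] := @torus_max (fun x => `|f x|); last by exists `|f c|.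
split; first by move=> z x; rewrite pf.
by move=> x; apply: (continuous_comp (cf x)); exact: norm_continuous.
Qed.

Lemma torus_max3 (f : 'rV[R]_n * 'rV[R]_n * 'rV[R]_n -> R) : continuous f ->
  (forall y z, Zperiodic (fun x => f (x, y, z))) ->
  (forall x z, Zperiodic (fun y => f (x, y, z))) ->
  (forall x y, Zperiodic (fun z => f (x, y, z))) ->
  exists c, forall d, f d <= f c.
Proof.
move=> cf p1 p2 p3.
have K3 : compact (cube `*` cube `*` cube).
  by do 2?apply: compact_setX; exact: cube_compact.
have K30 : cube `*` cube `*` cube !=set0.
  by have [x cx] := cube_neq0; exists (x, x, x).
have [c _ fc] := compact_EVT_max K30 K3 (continuous_subspaceT cf).
exists c => -[[x y] z].
have [a xa] := cube_repr x; have [b yb] := cube_repr y; have [d zd] := cube_repr z.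
rewrite -(p1 y z a x) -(p2 _ z b y) -(p3 _ _ d z).
by apply: fc; rewrite inE.
Qed.

(** Uniform continuity in the torus variable, measured by the periodic gap. On
    the compact set of triples of representatives where [F] oscillates by at
    least [e], the gap is continuous and has no zero, since a zero would make
    the two points equal modulo the lattice; its minimum there is the modulus. *)
Lemma torus_modulus (T : topologicalType) (K : set T) (F : 'rV[R]_n -> T -> R) :
  compact K -> continuous (fun z : 'rV[R]_n * T => F z.1 z.2) ->
  (forall p, Zperiodic (F^~ p)) ->
  forall e, 0 < e -> exists2 d, 0 < d &
    forall x y, gap y x < d -> forall p, K p -> `|F x p - F y p| < e.
Proof.
move=> cK cF pF e e0.
pose A := (cube `*` cube `*` K) `&`
  [set w : 'rV[R]_n * 'rV[R]_n * T | e <= `|F w.1.1 w.2 - F w.1.2 w.2|].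
have cA : compact A.
  apply: compact_closedI.
    by do 2?apply: compact_setX => //; exact: cube_compact.
  apply: (@closed_comp _ _ (fun w : 'rV[R]_n * 'rV[R]_n * T =>
    `|F w.1.1 w.2 - F w.1.2 w.2|) [set r | e <= r]); last exact: closed_ge.
  have c1 := @continuous_fst ('rV[R]_n * 'rV[R]_n)%type T.
  have c2 := @continuous_snd ('rV[R]_n * 'rV[R]_n)%type T.
  have c11 := continuous_compT c1 (@continuous_fst _ _).
  have c12 := continuous_compT c1 (@continuous_snd _ _).
  move=> w _; apply: cvg_norm; apply: cvgB.
    exact: (continuous_compT (continuous_pair c11 c2) cF).
  exact: (continuous_compT (continuous_pair c12 c2) cF).
have key d : (forall w, A w -> d <= gap w.1.2 w.1.1) ->
    forall x y, gap y x < d -> forall p, K p -> `|F x p - F y p| < e.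
  move=> dA x y yxd p Kp; rewrite ltNge; apply/negP => Fe.
  have [a xa] := cube_repr x; have [b yb] := cube_repr y.
  have := dA (x + map_mx intr a, y + map_mx intr b, p).
  rewrite /= gap_periodic gapC gap_periodic gapC leNgt yxd => /(_ _)/negP; apply => //.
  by split => //=; rewrite (pF p a) (pF p b).
have [A0|/nonemptyPn A0] := pselect (A !=set0); last first.
  by exists 1 => //; apply: key => w; rewrite A0.
have cgap : continuous (fun w : 'rV[R]_n * 'rV[R]_n * T => gap w.1.2 w.1.1).
  have c1 := @continuous_fst ('rV[R]_n * 'rV[R]_n)%type T.
  have c11 := continuous_compT c1 (@continuous_fst _ _).
  have c12 := continuous_compT c1 (@continuous_snd _ _).
  exact: (continuous_compT (continuous_pair c12 c11) (@gap_continuous R n)).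
have [c] := compact_EVT_min A0 cA (continuous_subspaceT cgap).
rewrite inE => -[_ /= ec] cmin.
exists (gap c.1.2 c.1.1); last by apply: key => w Aw; apply: cmin; rewrite inE.
rewrite lt_def gap_ge0 andbT; apply/negP => /eqP/gap_eq0[z zE].
by move: ec; rewrite zE (pF c.2 z) subrr normr0 leNgt e0.
Qed.

End torus_compactness.

(** * Two properties of viscosity test functions *)

Section viscosity_tests.
Variables (R : realType) (n : nat).
Implicit Types (u w psi : 'rV[R]_n -> R) (x y : 'rV[R]_n).

Definition lipschitz_const (M K : R) : R :=
  (M *+ 2 + n.+1%:R * (K + 1)) * (n.+1%:R * (pi *+ 2)).

Lemma sqrt_gap_le x y : Num.sqrt (gap x y) <= n.+1%:R * (pi *+ 2) * `|y - x|.
Proof.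
have p0 : 0 <= pi *+ 2 :> R by rewrite mulrn_wge0// pi_ge0.
have b0 : 0 <= n.+1%:R * (pi *+ 2) * `|y - x| by rewrite !mulr_ge0.
rewrite -(ger0_norm b0) -sqrtr_sqr ler_sqrt ?sqr_ge0//.
apply: le_trans (gap_le x y) _.
rewrite [leRHS](_ : _ = n.+1%:R ^+ 2 * (`|y - x| * (pi *+ 2)) ^+ 2); last by ring.
rewrite ler_wpM2r ?sqr_ge0//.
by rewrite -natrX ler_nat (leq_trans (leqnSn n))// expnS leq_pmulr.
Qed.

(** A viscosity bound on gradients is a Lipschitz bound. One maximizes
    [u - k * sqrt (gap x)]. If the maximum is at [x], modulo the lattice, this is
    the Lipschitz estimate at [x]. Otherwise the square root is smooth at the
    maximum point, the size of [k] confines that point to the region where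
    [gap_le_grad] applies, and the gradient of the penalty is too large. *)
Lemma lipschitz_of_gradient_bound u (M K : R) : torus_continuous u -> 0 <= K ->
  (forall x, `|u x| <= M) ->
  (forall psi x, torus_C1 psi -> (forall y, u y - psi y <= u x - psi x) ->
    `|grad psi x| <= K) ->
  forall x y, `|u x - u y| <= lipschitz_const M K * `|x - y|.
Proof.
move=> cu K0 uM uK.
suff H x y : u y - u x <= lipschitz_const M K * `|y - x|.
  by move=> x y; rewrite ler_norml lerNl opprB H andbT distrC H.
have M0 : 0 <= M by apply: le_trans (uM 0).
pose k := M *+ 2 + n.+1%:R * (K + 1).
have n1 : 1 <= n.+1%:R :> R by rewrite ler1n.
have nK1 : n.+1%:R * K < n.+1%:R * (K + 1) by rewrite ltr_pM2l ?ltrDl.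
have nK0 : 0 <= n.+1%:R * K by rewrite mulr_ge0.
have kM : M *+ 2 + n.+1%:R * K < k by rewrite /k ltrD2l.
have k0 : 0 < k by apply: le_lt_trans kM; rewrite addr_ge0// mulrn_wge0.
have [c cmax] : exists c, forall y, u y - k * Num.sqrt (gap x y) <=
                                    u c - k * Num.sqrt (gap x c).
  apply: torus_max; split; first by move=> z t; rewrite (cu.1 z) gap_periodic.
  have [_ df _] := gap_C1 x.
  move=> t; have Ft : Filter (nbhs t) := nbhs_filter t.
  apply: cvgB; first exact: (cu.2 t).
  apply: cvgM; first exact: cvg_cst.
  apply: (@continuous_comp _ _ _ (gap x) Num.sqrt).
    exact: differentiable_continuous.
  exact: sqrt_continuous.
have [g0|gn0] := eqVneq (gap x c) 0.
  have [z cE] := gap_eq0 g0.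
  have := cmax y; rewrite g0 sqrtr0 mulr0 subr0 cE (cu.1 z x) lerBlDr => h.
  rewrite lerBlDl (le_trans h)// lerD2l.
  have -> : lipschitz_const M K * `|y - x| = k * (n.+1%:R * (pi *+ 2) * `|y - x|).
    by rewrite mulrA.
  by apply: ler_wpM2l; [exact: ltW|exact: sqrt_gap_le].
exfalso.
pose s := Num.sqrt (gap x c).
have s0 : 0 < s by rewrite sqrtr_gt0 lt_def gn0 gap_ge0.
have sE : gap x c = s ^+ 2 by rewrite sqr_sqrtr// gap_ge0.
have ks : k * s <= k.
  have := cmax x; rewrite gapxx sqrtr0 mulr0 subr0 -/s => h.
  have := uM x; have := uM c; rewrite !ler_norml => /andP[_ h1] /andP[h2 _].
  lra.
have s1 : s <= 1 by rewrite -(ler_pM2l k0) mulr1.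
(* By the arithmetic-geometric mean inequality the function a * gap x + k * s / 2
   lies above k * sqrt (gap x) and meets it at c, where sqrt (gap x c) = s: it
   is an admissible test function with the same gradient. *)
pose a := k / (s *+ 2).
have aE : a * s = k / 2.
  by rewrite /a -mulr_natr; field; rewrite ?lt0r_neq0.
have a0 : 0 <= a by rewrite divr_ge0// ?mulrn_wge0// ltW.
have cgrad : `|grad (fun y => a * gap x y) c| <= K.
  apply: uK; first exact: torus_C1Z (gap_C1 x).
  move=> t; have := cmax t; rewrite -/s sE.
  have := sqr_sqrtr (gap_ge0 x t); set r := Num.sqrt _ => <- h.
  suff : 0 <= a * (r - s) ^+ 2.
    have -> : a * (r - s) ^+ 2 = a * r ^+ 2 - (a * s) * r *+ 2 + (a * s) * s.
      by ring.
    rewrite aE -(mulr_natr (_ * r) 2); set r2 := a * r ^+ 2 => h'.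
    have -> : a * s ^+ 2 = k / 2 * s by rewrite -aE; ring.
    lra.
  by rewrite mulr_ge0 ?sqr_ge0.
move: cgrad; rewrite gradZ; last by have [_ ] := gap_C1 x.
move=> cgrad.
have : (pi *+ 2) ^+ 2 * gap x c <= \sum_k (grad (gap x) c 0 k) ^+ 2.
  by apply: gap_le_grad; rewrite sE expr_le1// ltW.
move=> /(ler_wpM2l (sqr_ge0 a)); rewrite [leRHS]mulr_sumr => h.
have : \sum_(j < n) a ^+ 2 * grad (gap x) c 0 j ^+ 2 <= n%:R * K ^+ 2.
  rewrite -[n in n%:R]card_ord mulr_natl -sumr_const; apply: ler_sum => j _.
  rewrite -exprMn -real_normK ?num_real// lerXn2r ?nnegrE//.
  apply: le_trans cgrad; have := norm_coord_le (a *: grad (gap x) c) j.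
  by rewrite mxE.
move=> /(le_trans h).
have -> : a ^+ 2 * ((pi *+ 2) ^+ 2 * gap x c) = (a * s) ^+ 2 * pi ^+ 2 *+ 4.
  by rewrite sE; ring.
rewrite aE => {}h.
have pi1 : 1 <= pi ^+ 2 :> R.
  by rewrite expr_ge1 ?pi_ge0// (le_trans _ (pi_ge2 R))// ler1n.
have : k ^+ 2 <= n%:R * K ^+ 2.
  apply: le_trans h; rewrite -mulr_natr.
  have -> : (k / 2) ^+ 2 * pi ^+ 2 * 4%:R = k ^+ 2 * pi ^+ 2 by field.
  by rewrite ler_peMr// sqr_ge0.
apply/negP; rewrite -ltNge.
have nK : n%:R * K ^+ 2 <= (n.+1%:R * K) ^+ 2.
  by rewrite exprMn ler_wpM2r ?sqr_ge0// -natrX ler_nat (leq_trans (leqnSn n))// expnS leq_pmulr.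
apply: le_lt_trans nK _.
have : n.+1%:R * K < k by apply: le_lt_trans kM; rewrite lerDr mulrn_wge0.
by move=> ?; rewrite ltrXn2r// ?nnegrE ?mulr_ge0// ltW.
Qed.

(** Subtracting the gap makes the maximum point [x0] of [w - psi] strict modulo
    the lattice, so a uniformly close function attains its own maximum nearby. *)
Lemma perturbed_max w u psi x0 (d : R) :
  torus_C1 psi -> torus_continuous u ->
  (forall y, w y - psi y <= w x0 - psi x0) -> (forall y, `|u y - w y| <= d) ->
  exists x, gap x0 x <= d *+ 2 /\
    (forall y, u y - (psi y + gap x0 y) <= u x - (psi x + gap x0 x)).
Proof.
move=> Cpsi [pu cu] wmax uw.
have [pt dt _] := torus_C1D Cpsi (gap_C1 x0).
have [x xmax] : exists x, forall y, u y - (psi y + gap x0 y) <= u x - (psi x + gap x0 x).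
  apply: torus_max; split; first by move=> z y; rewrite pu (pt z y).
  move=> y; have Fy : Filter (nbhs y) := nbhs_filter y.
  by apply: cvgB; [exact: (cu y)|exact: (differentiable_continuous (dt y))].
exists x; split => //.
have := xmax x0; have := wmax x; have := uw x; have := uw x0.
by rewrite !ler_norml gapxx => /andP[? ?] /andP[? ?] ? ?; lra.
Qed.

End viscosity_tests.

(** * The Hamiltonian *)

Lemma sup_range_max (R : realType) (Xi : topologicalType) (F : Xi -> R) :
  [set: Xi] !=set0 -> compact [set: Xi] -> continuous F ->
  exists2 c, sup (range F) = F c & forall xi, F xi <= F c.
Proof.
move=> Xi0 cXi cF.
have [c _ Fc] := compact_EVT_max Xi0 cXi (continuous_subspaceT cF).
have {}Fc xi : F xi <= F c by apply: Fc; rewrite inE.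
exists c => //; apply/eqP; rewrite eq_le; apply/andP; split.
  by apply: ge_sup; [exists (F c), c|move=> _ [xi _ <-]].
by apply: ub_le_sup; [exists (F c) => _ [xi _ <-]|exists c].
Qed.

(** Compactness of the parameter space makes the continuity of [F] at [x]
    uniform in the parameter, and suprema of uniformly close functions are
    close. *)
Lemma continuous_sup_range (R : realType) (T Xi : topologicalType) (F : T -> Xi -> R) :
  [set: Xi] !=set0 -> compact [set: Xi] ->
  continuous (fun z : T * Xi => F z.1 z.2) ->
  continuous (fun y => sup (range (F y))).
Proof.
move=> Xi0 cXi cF x.
have cFy y : continuous (F y).
  apply: (@continuous_compT _ _ _ (fun xi => (y, xi)) (fun z => F z.1 z.2)) cF.
  by apply: continuous_pair => xi; [exact: cvg_cst|exact: cvg_id].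
apply/cvgrPdist_le => e e0.
have unif : \forall y \near x, [set: Xi] `<=` (fun xi => `|F x xi - F y xi| <= e).
  apply: ((compact_near_coveringP [set: Xi]).1 cXi T (nbhs x)
    (fun y xi => `|F x xi - F y xi| <= e)) => xi _.
  have e20 : 0 < e / 2 by rewrite divr_gt0.
  have /cvgrPdist_le/(_ _ e20) := cF (x, xi).
  case=> -[/= U V] [xU xiV] UV; exists (V, U) => // -[/= xi' y] [Vxi' Uy].
  have h1 := UV (y, xi') (conj Uy Vxi').
  have h2 := UV (x, xi') (conj (nbhs_singleton xU) Vxi').
  rewrite (_ : F x xi' - F y xi' =
    (F x xi - F y xi') - (F x xi - F x xi')); last by ring.
  by rewrite [e]splitr (le_trans (ler_normB _ _))// lerD.
apply: filterS unif => y unif_.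
have {}unif xi : `|F x xi - F y xi| <= e by exact: unif_.
have [a -> Fa] := sup_range_max Xi0 cXi (cFy x).
have [b -> Fb] := sup_range_max Xi0 cXi (cFy y).
have := unif a; have := unif b; have := Fa b; have := Fb a.
by rewrite !ler_norml => ? ? /andP[? ?] /andP[? ?]; apply/andP; split; lra.
Qed.

Section dot_product.
Variables (R : realType) (n : nat).
Implicit Types p q r : 'rV[R]_n.

Lemma dotDr r p q : dot r (p + q) = dot r p + dot r q.
Proof. by rewrite -big_split; apply: eq_bigr => k _; rewrite mxE mulrDr. Qed.

Lemma dotZr r a p : dot r (a *: p) = a * dot r p.
Proof. by rewrite mulr_sumr; apply: eq_bigr => k _; rewrite mxE mulrCA. Qed.

Lemma continuous_dot (T : topologicalType) (f h : T -> 'rV[R]_n) :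
  continuous f -> continuous h -> continuous (fun z => dot (f z) (h z)).
Proof.
move=> cf ch z; apply: cvg_big => [|k _]; first exact: add_continuous.
have cc : continuous (fun v : 'rV[R]_n => v 0 k) by exact: coord_continuous.
have fc : f x 0 k @[x --> z] --> f z 0 k by apply: (continuous_compT cf cc).
have hc : h x 0 k @[x --> z] --> h z 0 k by apply: (continuous_compT ch cc).
exact: (cvgM fc hc).
Qed.

End dot_product.

Section hamiltonian.
Variables (R : realType) (m n : nat) (Xi : topologicalType).
Variables (g : 'I_m -> 'rV[R]_n -> Xi -> 'rV[R]_n) (L : 'I_m -> 'rV[R]_n -> Xi -> R).
Hypotheses (Xi_neq0 : [set: Xi] !=set0) (Xi_compact : compact [set: Xi]).
Hypotheses (g_periodic : forall i, Zperiodic (g i))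
  (g_continuous : forall i, continuous (fun z : 'rV[R]_n * Xi => g i z.1 z.2))
  (L_periodic : forall i, Zperiodic (L i))
  (L_continuous : forall i, continuous (fun z : 'rV[R]_n * Xi => L i z.1 z.2)).

Lemma hamiltonian_periodic i p : Zperiodic (fun x => hamiltonian g L i x p).
Proof. by move=> z x; rewrite /hamiltonian g_periodic L_periodic. Qed.

Lemma hamiltonian_continuous i :
  continuous (fun z : 'rV[R]_n * 'rV[R]_n => hamiltonian g L i z.1 z.2).
Proof.
apply: (@continuous_sup_range _ ('rV[R]_n * 'rV[R]_n)%type Xi
  (fun z xi => - dot (g i z.1 xi) z.2 - L i z.1 xi)) => //.
have c1 := @continuous_fst ('rV[R]_n * 'rV[R]_n)%type Xi.
have c2 := @continuous_snd ('rV[R]_n * 'rV[R]_n)%type Xi.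
have c11 := continuous_compT c1 (@continuous_fst _ _).
have c12 := continuous_compT c1 (@continuous_snd _ _).
move=> z; apply: cvgB; last first.
  exact: (continuous_compT (continuous_pair c11 c2) (@L_continuous i)).
apply: cvgN; apply: (continuous_dot _ c12).
exact: (continuous_compT (continuous_pair c11 c2) (@g_continuous i)).
Qed.

Lemma hamiltonian_convex i x p q (t : R) : 0 <= t <= 1 ->
  hamiltonian g L i x ((1 - t) *: p + t *: q) <=
    (1 - t) * hamiltonian g L i x p + t * hamiltonian g L i x q.
Proof.
move=> /andP[t0 t1].
have [[xi ->] _] := hamiltonian_is_max x ((1 - t) *: p + t *: q) Xi_neq0 Xi_compact
  (@g_continuous i) (@L_continuous i).
have [_ /(_ xi) Hp] := hamiltonian_is_max x p Xi_neq0 Xi_compact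
  (@g_continuous i) (@L_continuous i).
have [_ /(_ xi) Hq] := hamiltonian_is_max x q Xi_neq0 Xi_compact
  (@g_continuous i) (@L_continuous i).
have t1' : 0 <= 1 - t by rewrite subr_ge0.
have := ler_wpM2l t1' Hp; have := ler_wpM2l t0 Hq.
rewrite dotDr !dotZr; set A := dot _ _; set B := dot _ _; lra.
Qed.

Lemma hamiltonian_sublevel_bounded : coercive (hamiltonian g L) -> forall C : R,
  exists2 K, 0 <= K & forall i x p, hamiltonian g L i x p <= C -> `|p| <= K.
Proof.
move=> Hc C.
have bnd i : exists K, forall x p, hamiltonian g L i x p <= C -> `|p| <= K.
  have [K _ KC] := Hc i _ (nbhs_pinfty_gt (num_real C)).
  exists K => x p HC; rewrite leNgt; apply/negP => /KC /=.
  have [_ /(_ x) h] := hamiltonian_has_min p Xi_neq0 Xi_compact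
    (@g_periodic i) (@L_periodic i) (@g_continuous i) (@L_continuous i).
  by move=> /lt_le_trans/(_ h)/lt_le_trans/(_ HC); rewrite ltxx.
have [K HK] := choice bnd.
exists (\sum_i `|K i|); first by apply: sumr_ge0.
move=> i x p /HK h; rewrite (le_trans h)// (le_trans (ler_norm _))//.
by rewrite (bigD1 i)//= lerDl sumr_ge0.
Qed.

End hamiltonian.

(** * Equi-Lipschitz families along ultrafilters *)

(** A set outside [F] has a complement compatible with [F], and an ultrafilter
    refining [F] and this complement avoids the set. Convergence of a family can
    thus be tested on its ultrafilter limits. *)
Lemma ultrafilters_near (T : Type) (F : set_system T) (A : set T) : Filter F ->
  (forall U, UltraFilter U -> F `<=` U -> U A) -> F A.
Proof.
move=> FF UA; apply: contrapT => FA.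
have GF : ProperFilter (within (~` A) F).
  apply: Build_ProperFilter.
  move=> F0; apply: FA.
  have {}F0 : \forall x \near F, ~ A x -> False := F0.
  by apply: filterS F0 => x; exact: contrapT.
have [U [UU GU]] := ultraFilterLemma GF.
have FU : F `<=` U by move=> P FP; apply: GU; apply: filterS FP => x.
have UcA : U (~` A) by apply: GU; rewrite /within /=; exact: nearW.
have [x [Ax /(_ Ax)//]] := filter_ex (filterI (UA U UU FU) UcA).
Qed.

Section ultrafilter_limits.
Variables (R : realType) (T : Type) (U : set_system T).
Context {UU : UltraFilter U}.

Lemma bounded_ultra_limit (f : T -> R) (C : R) : (\forall s \near U, `|f s| <= C) ->
  exists l, forall e, 0 < e -> \forall s \near U, `|f s - l| < e.
Proof.
move=> fC.
have : (f @ U) [set` `[- C, C]].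
  by apply: filterS fC => s /=; rewrite in_itv/= ler_norml.
move=> /(@segment_compact R (- C) C (f @ U) _)[l [_ cl]].
exists l => e e0.
have [//|far] := in_ultra_setVsetC [set s | `|f s - l| < e] UU.
have [r [/= far_r]] := cl [set r | ~ `|r - l| < e] (ball l e) far (nbhsx_ballx _ _ e0).
by rewrite /ball /= distrC => /far_r.
Qed.

(** The Arzela-Ascoli theorem in ultrafilter form: boundedness gives pointwise
    limits, the common Lipschitz constant passes to the limit, and compactness of
    the unit cube turns the local estimates into a uniform one. *)
Lemma equilipschitz_ultra_limit (n : nat) (f : T -> 'rV[R]_n -> R) (C K : R) :
  (\forall s \near U, Zperiodic (f s)) -> (\forall s \near U, forall x, `|f s x| <= C) ->
  (\forall s \near U, forall x y, `|f s x - f s y| <= K * `|x - y|) ->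
  exists w, [/\ Zperiodic w, forall x y, `|w x - w y| <= K * `|x - y| &
    forall e, 0 < e -> \forall s \near U, forall x, `|f s x - w x| <= e].
Proof.
move=> pf fC fK.
have ptw x : exists l, forall e, 0 < e -> \forall s \near U, `|f s x - l| < e.
  by apply: (bounded_ultra_limit (C := C)); apply: filterS fC.
have [w wP] := choice ptw.
have pw : Zperiodic w.
  move=> z x; apply/eqP; rewrite -subr_eq0 -normr_le0; apply/ler_addgt0Pr => e e0.
  have e20 : 0 < e / 2 by rewrite divr_gt0.
  have [s [[/= h1 h2] ps]] :=
    filter_ex (filterI (filterI (wP x _ e20) (wP (x + map_mx intr z) _ e20)) pf).
  move: h1 h2; rewrite ps !ltr_norml add0r ler_norml => /andP[? ?] /andP[? ?].
  by apply/andP; split; lra.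
have wK x y : `|w x - w y| <= K * `|x - y|.
  apply/ler_addgt0Pr => e e0.
  have e20 : 0 < e / 2 by rewrite divr_gt0.
  have [s [[h1 h2] /(_ x y) h3]] :=
    filter_ex (filterI (filterI (wP x _ e20) (wP y _ e20)) fK).
  move: h1 h2 h3; rewrite !ltr_norml !ler_norml.
  by move=> /andP[? ?] /andP[? ?] /andP[? ?]; apply/andP; split; lra.
exists w; split => // e e0.
have k0 : 0 < `|K| + 1 by rewrite ltr_wpDl.
pose r := e / 4 / (`|K| + 1).
have r0 : 0 < r by rewrite !divr_gt0.
have Kr t : 0 <= t -> t < r -> K * t <= e / 4.
  move=> t_ge0 tr; rewrite (le_trans (ler_wpM2r t_ge0 (ler_norm K)))//.
  have -> : e / 4 = (`|K| + 1) * r by rewrite /r; field; rewrite lt0r_neq0.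
  by apply: ler_pM => //; [rewrite lerDl|exact: ltW].
have near_x x : cube x -> \forall x' \near x & s \near U, `|f s x' - w x'| <= e.
  move=> _.
  have e40 : 0 < e / 4 by rewrite divr_gt0.
  exists (ball x r, [set s | `|f s x - w x| < e / 4 /\
    forall x y, `|f s x - f s y| <= K * `|x - y|]).
    by split; [exact: nbhsx_ballx|exact: filterI (wP x _ e40) fK].
  move=> [x' s] /= [xx' [h1 /(_ x' x) h2]].
  have xr : `|x - x'| < r by move: xx'; rewrite -ball_normE.
  have := Kr _ (normr_ge0 _) xr; have := wK x x'; move: h1 h2.
  rewrite (distrC x' x); set t := K * _; rewrite ltr_norml !ler_norml.
  by move=> /andP[? ?] /andP[? ?] /andP[? ?] ?; apply/andP; split; lra.
have cov : \forall s \near U, forall x, cube x -> `|f s x - w x| <= e.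
  exact: ((compact_near_coveringP (@cube R n)).1 (@cube_compact R n) T U
    (fun s x => `|f s x - w x| <= e) _ near_x).
apply: filterS (filterI cov pf) => s [hs ps] x; have [z zx] := cube_repr x.
by rewrite -(ps z) -(pw z); exact: hs.
Qed.

End ultrafilter_limits.

Lemma equilipschitz_torus_lipschitz (R : realType) (n : nat) (f : 'rV[R]_n -> R) (K : R) :
  Zperiodic f -> (forall x y, `|f x - f y| <= K * `|x - y|) -> torus_lipschitz f.
Proof.
move=> pf fK; split=> //; apply: (@klipschitzW _ _ _ K).
  exact: globally_properfilter (0, 0) _.
by move=> [x y] _ /=; exact: fK.
Qed.

Lemma torus_lipschitz_continuous (R : realType) (n : nat) (f : 'rV[R]_n -> R) :
  torus_lipschitz f -> torus_continuous f.
Proof.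
move=> [pf [M [_ fM]]]; split=> // x.
pose K := `|M| + 1.
have K0 : 0 < K by rewrite ltr_wpDl.
have fK y : `|f x - f y| <= K * `|x - y|.
  have MK : M < K by rewrite (le_lt_trans (ler_norm M))// ltrDl.
  exact: (fM K MK (x, y)).
have Fx : Filter (nbhs x) := nbhs_filter x.
apply/cvgrPdist_le => e e0.
apply: filterS (nbhsx_ballx x _ (divr_gt0 e0 K0)) => y.
rewrite -ball_normE /= => xy.
by rewrite (le_trans (fK y))// -ler_pdivlMl// mulrC ltW.
Qed.

(** * Comparison for weakly coupled convex systems *)

Lemma torus_bounded_family (R : realType) (n : nat) (I : finType)
    (u : I -> 'rV[R]_n -> R) : (forall i, torus_continuous (u i)) ->
  exists2 M, 0 <= M & forall i x, `|u i x| <= M.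
Proof.
move=> cu; have [M uM] := choice (fun i => torus_bounded (cu i)).
exists (\sum_i `|M i|); first by apply: sumr_ge0.
move=> i x; rewrite (le_trans (uM i x))// (le_trans (ler_norm _))//.
by rewrite (bigD1 i)//= lerDl sumr_ge0.
Qed.

Lemma torus_modulus_family (R : realType) (n : nat) (I : finType)
    (T : topologicalType) (K : set T) (F : I -> 'rV[R]_n -> T -> R) :
  compact K -> (forall i, continuous (fun z : 'rV[R]_n * T => F i z.1 z.2)) ->
  (forall i p, Zperiodic ((F i)^~ p)) ->
  forall e, 0 < e -> exists2 d, 0 < d & forall i x y, gap y x < d ->
    forall p, K p -> `|F i x p - F i y p| < e.
Proof.
move=> cK cF pF e e0.
have ex i : exists d, 0 < d /\ forall x y, gap y x < d ->
    forall p, K p -> `|F i x p - F i y p| < e.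
  by have [d d0 dF] := torus_modulus cK (cF i) (pF i) e0; exists d.
have [d dP] := choice ex.
exists (\big[Num.min/1]_i d i).
  by apply/bigmin_gtP; split=> // i _; exact: (dP i).1.
move=> i x y xyd; apply: (dP i).2; apply: lt_le_trans xyd _.
exact: bigmin_le_cond.
Qed.

Section weakly_coupled_system.
Variables (R : realType) (m n : nat).
Variables (B : 'rV[R]_n -> 'M[R]_m) (H : 'I_m -> 'rV[R]_n -> 'rV[R]_n -> R).
Hypotheses (B_continuous : forall i j, torus_continuous (fun x => B x i j))
  (B_monotone : forall x, monotone_matrix (B x))
  (H_periodic : forall i p, Zperiodic (fun x => H i x p))
  (H_continuous : forall i, continuous (fun z : 'rV[R]_n * 'rV[R]_n => H i z.1 z.2))
  (H_convex : forall i x p q (t : R), 0 <= t <= 1 ->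
    H i x ((1 - t) *: p + t *: q) <= (1 - t) * H i x p + t * H i x q)
  (H_coercive : forall C : R, exists2 K, 0 <= K &
    forall i x p, H i x p <= C -> `|p| <= K).
Implicit Types (u v : 'I_m -> 'rV[R]_n -> R).

Lemma zeroth_order_continuous (lam : R) u i : (forall i, torus_continuous (u i)) ->
  torus_continuous (fun x => lam * u i x + apply_coupling B u i x).
Proof.
move=> cu; split.
  move=> z x; rewrite (cu i).1 /apply_coupling; congr (_ + _).
  by apply: eq_bigr => j _; rewrite (B_continuous i j).1 (cu j).1.
move=> x; have Fx : Filter (nbhs x) := nbhs_filter x.
apply: cvgD; first by apply: cvgM; [exact: cvg_cst|exact: ((cu i).2 x)].
apply: cvg_big => [|j _]; first exact: add_continuous.
by apply: cvgM; [exact: ((B_continuous i j).2 x)|exact: ((cu j).2 x)].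
Qed.

Lemma system_lhs_continuous (lam : R) u i : (forall i, torus_continuous (u i)) ->
  continuous (fun z : 'rV[R]_n * 'rV[R]_n =>
    lam * u i z.1 + apply_coupling B u i z.1 + H i z.1 z.2).
Proof.
move=> cu; have [_ c0] := zeroth_order_continuous lam i cu.
have c1 := continuous_compT (@continuous_fst 'rV[R]_n 'rV[R]_n) c0.
by move=> z; apply: cvgD; [exact: c1|exact: H_continuous].
Qed.

(** A subsolution inequality bounds the Hamiltonian from above at every test
    gradient, hence, by coercivity, the test gradient itself. The bound [K] does
    not depend on the subsolution. *)
Lemma subsolution_gradient_bound (C : R) : exists2 K, 0 <= K & forall lam u,
  is_subsolution lam B H u ->
  (forall i x, `|lam * u i x + apply_coupling B u i x| <= C) ->
  forall i psi x, torus_C1 psi -> (forall y, u i y - psi y <= u i x - psi x) ->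
    `|grad psi x| <= K.
Proof.
have [K K0 HK] := H_coercive C; exists K => // lam u [_ su] uC i psi x Cpsi xmax.
apply: (HK i x); have := su i psi x Cpsi xmax; have := uC i x.
by rewrite ler_norml => /andP[? ?] ?; lra.
Qed.

(** The subsolution inequality at a test point can be moved to any nearby point
    with the same gradient: test gradients stay in a fixed ball, on which the
    equation is uniformly continuous. *)
Lemma subsolution_shift (lam : R) u : is_subsolution lam B H u ->
  forall e, 0 < e -> exists2 d, 0 < d & forall i psi x z,
    torus_C1 psi -> (forall y, u i y - psi y <= u i x - psi x) -> gap z x < d ->
    lam * u i z + apply_coupling B u i z + H i z (grad psi x) <= e /\
    `|u i x - u i z| <= e.
Proof.
move=> sub e e0; have [cu su] := sub.
have [C _ uC] := torus_bounded_family (fun i => zeroth_order_continuous lam i cu).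
have [K K0 HK] := subsolution_gradient_bound C.
pose D := [set p : 'rV[R]_n | `|p| <= K].
have cD : compact D.
  apply: bounded_closed_compact.
    exists K; split; first exact: num_real.
    by move=> r Kr p Dp; exact: (le_trans Dp (ltW Kr)).
  apply: (@closed_comp _ _ (fun p : 'rV[R]_n => `|p|) [set r | r <= K]).
    by move=> p _; exact: norm_continuous.
  exact: closed_le.
have [d1 d10 D1] := torus_modulus_family cD
  (fun i => @system_lhs_continuous lam u i cu)
  (fun i p z x => congr2 +%R ((zeroth_order_continuous lam i cu).1 z x)
    (@H_periodic i p z x)) e0.
have [d2 d20 D2] := torus_modulus_family cD
  (fun i => continuous_compT (@continuous_fst _ 'rV[R]_n) (cu i).2)
  (fun i p => (cu i).1) e0.
exists (Num.min d1 d2) => [|i psi x z Cpsi xmax]; first by rewrite lt_min d10.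
have gD : D (grad psi x) by exact: (HK lam u sub uC i).
rewrite lt_min => /andP[/(D1 i x z)/(_ _ gD) h1 /(D2 i x z)/(_ _ gD) h2].
split; last exact: ltW.
have := su i psi x Cpsi xmax; move: h1; rewrite ltr_norml => /andP[? ?] ?; lra.
Qed.

(** Monotonicity of the matrix at an index where [w] is only close to its upper
    bound [P]: raise that entry to [P], which makes it a maximum. *)
Lemma coupling_at_near_max x (w : 'I_m -> R) k (P : R) : 0 <= P ->
  (forall j, w j <= P) -> B x k k * (w k - P) <= \sum_j B x k j * w j.
Proof.
move=> P0 wP.
have := @B_monotone x (\col_j if j == k then P else w j) k.
rewrite !mxE eqxx => /(_ _ P0) h.
have {}h : 0 <= \sum_j B x k j * (if j == k then P else w j).
  suff -> : \sum_j B x k j * (if j == k then P else w j) =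
      (B x *m (\col_j (if j == k then P else w j))) k 0.
    by rewrite mxE; apply: h => i; rewrite mxE; case: ifP.
  by rewrite mxE; apply: eq_bigr => j _; rewrite mxE.
move: h; rewrite (bigD1 k)//= [in X in _ -> X](bigD1 k)//= eqxx.
rewrite (eq_bigr (fun j => B x k j * w j)) => [|j /negPf ->//].
set S := \sum_(j < m | _) _; lra.
Qed.


(** The comparison principle for a convex combination of two subsolutions and a
    supersolution, in one step: each function receives its own variable, and the
    two variables [x], [y] of the subsolutions are tied to the variable [z] of the
    supersolution with weights [1 - t] and [t]. At a maximum point the test
    gradient of the supersolution is then the convex combination, with the same
    weights, of those of the subsolutions, which is where convexity of the
    Hamiltonian enters. The conclusion produces a point where the combination
    almost reaches any prescribed nonnegative value [M0] that it attains, and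
    where the zeroth-order discount terms are almost ordered; the Hamiltonian and
    the coupling have disappeared. *)
Lemma convex_comparison (lam1 lam2 lam3 t : R) u1 u2 v j0 z0 (M0 e : R) :
  0 < t < 1 -> is_subsolution lam1 B H u1 -> is_subsolution lam2 B H u2 ->
  is_supersolution lam3 B H v ->
  0 <= M0 -> M0 <= (1 - t) * u1 j0 z0 + t * u2 j0 z0 - v j0 z0 -> 0 < e ->
  exists k z, M0 - e <= (1 - t) * u1 k z + t * u2 k z - v k z /\
    (1 - t) * (lam1 * u1 k z) + t * (lam2 * u2 k z) - lam3 * v k z <= e.
Proof.
move=> /andP[t0 t1] sub1 sub2 [cv sv] M00 M0le e0.
have [cu1 _] := sub1; have [cu2 _] := sub2.
have s0 : 0 < 1 - t by rewrite subr_gt0.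
have [M1 M10 u1M] := torus_bounded_family cu1.
have [M2 M20 u2M] := torus_bounded_family cu2.
have [Cb Cb0 BC] := torus_bounded_family (fun i => B_continuous i i).
pose h := e / (1 + Cb).
have Cb1 : 0 < 1 + Cb by rewrite ltr_pwDl.
have h0 : 0 < h by rewrite divr_gt0.
have hE : h + Cb * h = e by rewrite /h; field; rewrite lt0r_neq0.
have [d1 d10 D1] := subsolution_shift sub1 h0.
have [d2 d20 D2] := subsolution_shift sub2 h0.
pose d := Num.min d1 d2.
have d0 : 0 < d by rewrite lt_min d10.
pose M := (M1 + M2) *+ 2 + 1.
(* Comparing with the diagonal, the weighted penalty at a maximum point is less
   than M, and this penalization then forces both gaps below d. *)
pose a := M / (d * ((1 - t) * t)).
have M_gt0 : 0 < M by rewrite ltr_wpDl// mulrn_wge0// addr_ge0.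
have st0 : 0 < (1 - t) * t by rewrite mulr_gt0.
have a0 : 0 < a by rewrite divr_gt0// mulr_gt0.
have ad : a * d * ((1 - t) * t) = M by rewrite /a; field; rewrite !lt0r_neq0.
pose Phi j (c : 'rV[R]_n * 'rV[R]_n * 'rV[R]_n) :=
  (1 - t) * (u1 j c.1.1 - a * gap c.2 c.1.1) + t * (u2 j c.1.2 - a * gap c.2 c.1.2)
  - v j c.2.
have Pmax j : exists c, forall c', Phi j c' <= Phi j c.
  apply: torus_max3.
  - have c2 := @continuous_snd ('rV[R]_n * 'rV[R]_n)%type 'rV[R]_n.
    have c1 := @continuous_fst ('rV[R]_n * 'rV[R]_n)%type 'rV[R]_n.
    have c11 := continuous_compT c1 (@continuous_fst _ _).
    have c12 := continuous_compT c1 (@continuous_snd _ _).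
    have g1 := continuous_compT (continuous_pair c2 c11) (@gap_continuous R n).
    have g2 := continuous_compT (continuous_pair c2 c12) (@gap_continuous R n).
    have f1 := continuous_compT c11 (cu1 j).2.
    have f2 := continuous_compT c12 (cu2 j).2.
    have f3 := continuous_compT c2 (cv j).2.
    move=> c; apply: cvgB; last exact: f3.
    apply: cvgD.
      apply: cvgM; first exact: cvg_cst.
      by apply: cvgB; [exact: f1|apply: cvgM; [exact: cvg_cst|exact: g1]].
    apply: cvgM; first exact: cvg_cst.
    by apply: cvgB; [exact: f2|apply: cvgM; [exact: cvg_cst|exact: g2]].
  - by move=> y z b x; rewrite /Phi /= (cu1 j).1 gap_periodic.
  - by move=> x z b y; rewrite /Phi /= (cu2 j).1 gap_periodic.
  - move=> x y b z; rewrite /Phi /= (cv j).1.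
    by rewrite ![gap (z + _) _]gapC !gap_periodic ![gap _ z]gapC.
have [c cmax] := choice Pmax.
(* The index is maximized as well, so that the coupling at this index can be
   estimated by monotonicity. *)
have [k _ kmax] := @arg_maxP _ _ _ j0 xpredT (fun j => Phi j (c j)) isT.
have {}kmax j c' : Phi j c' <= Phi k (c k) by apply: le_trans (cmax j c') (kmax j isT).
move: (c k) kmax => -[[x y] z] kmax {cmax c}.
pose P := Phi k (x, y, z).
have diag j w : (1 - t) * u1 j w + t * u2 j w - v j w <= P.
  by have := kmax j (w, w, w); rewrite {1}/Phi /= gapxx mulr0 !subr0.
have M0P : M0 <= P by exact: le_trans M0le (diag j0 z0).
have PE : P = (1 - t) * (u1 k x - a * gap z x) + t * (u2 k y - a * gap z y) - v k z.
  by [].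
have gx0 : 0 <= a * gap z x by rewrite mulr_ge0 ?gap_ge0// ltW.
have gy0 : 0 <= a * gap z y by rewrite mulr_ge0 ?gap_ge0// ltW.
have sgx0 := mulr_ge0 (ltW s0) gx0.
have tgy0 := mulr_ge0 (ltW t0) gy0.
have close : (1 - t) * (a * gap z x) + t * (a * gap z y) < M.
  have := diag k z; rewrite PE /M => hd.
  have := u1M k x; have := u1M k z; have := u2M k y; have := u2M k z.
  rewrite !ler_norml => /andP[? ?] /andP[? ?] /andP[? ?] /andP[? ?].
  have : (1 - t) * (u1 k x - u1 k z) <= M1 *+ 2 by nra.
  have : t * (u2 k y - u2 k z) <= M2 *+ 2 by nra.
  lra.
have gxd : gap z x < d.
  rewrite ltNge; apply/negP => dx.
  have := ler_wpM2l (ltW s0) (ler_wpM2l (ltW a0) dx).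
  have : M <= (1 - t) * (a * d) by rewrite -ad; nra.
  by move: close; lra.
have gyd : gap z y < d.
  rewrite ltNge; apply/negP => dy.
  have := ler_wpM2l (ltW t0) (ler_wpM2l (ltW a0) dy).
  have : M <= t * (a * d) by rewrite -ad; nra.
  by move: close; lra.
move: gxd gyd; rewrite !lt_min => /andP[gx _] /andP[_ gy].
have [|y'|H1 U1] := D1 k (fun y' => a * gap z y') x z _ _ gx.
- exact: torus_C1Z (gap_C1 z).
- have := kmax k (y', y, z); rewrite /Phi/= => hh.
  by rewrite -(ler_pM2l s0); lra.
have [|y'|H2 U2] := D2 k (fun y' => a * gap z y') y z _ _ gy.
- exact: torus_C1Z (gap_C1 z).
- have := kmax k (x, y', z); rewrite /Phi/= => hh.
  by rewrite -(ler_pM2l t0); lra.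
pose psi w := (- ((1 - t) * a)) * gap x w + (- (t * a)) * gap y w.
have H3 : 0 <= lam3 * v k z + apply_coupling B v k z + H k z (grad psi z).
  apply: sv; first by apply: torus_C1D; exact: torus_C1Z (gap_C1 _).
  move=> w; have := kmax k (x, y, w); rewrite /Phi/= => hh.
  by rewrite /psi !(gapC _ z) !(gapC _ w); lra.
have psiE : grad psi z = (1 - t) *: grad (fun w => a * gap z w) x +
    t *: grad (fun w => a * gap z w) y.
  have dg b := @gap_differentiable R n b.
  have dZ r b w : differentiable (fun w => r * gap b w) w.
    by case: (torus_C1Z r (gap_C1 b)) => _ + _; exact.
  by rewrite gradD// !gradZ// (grad_gapC x) (grad_gapC y) !scaleNr !scalerN !opprK !scalerA.
have := @H_convex k z (grad (fun w => a * gap z w) x) (grad (fun w => a * gap z w) y) t.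
rewrite -psiE (ltW t0) (ltW t1) => /(_ isT) Hc.
have th : P - h <= (1 - t) * u1 k z + t * u2 k z - v k z.
  move: U1 U2; rewrite !ler_norml PE => /andP[_ hx] /andP[_ hy].
  have := ler_wpM2l (ltW s0) hx; have := ler_wpM2l (ltW t0) hy; lra.
exists k, z; split.
  have : h <= e by rewrite -hE lerDl mulr_ge0// ltW.
  by move: th; lra.
have P0 : 0 <= P by exact: le_trans M0P.
have := @coupling_at_near_max z (fun j => (1 - t) * u1 j z + t * u2 j z - v j z) k P P0
  (fun j => diag j z).
have -> : \sum_j B z k j * ((1 - t) * u1 j z + t * u2 j z - v j z) =
    (1 - t) * apply_coupling B u1 k z + t * apply_coupling B u2 k z
    - apply_coupling B v k z.
  rewrite /apply_coupling !mulr_sumr -big_split -sumrB.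
  by apply: eq_bigr => j _ /=; ring.
have Bh : - (Cb * h) <= B z k k * ((1 - t) * u1 k z + t * u2 k z - v k z - P).
  have := BC k z; have := diag k z; rewrite ler_norml; move: th.
  set b := B z k k; set q := _ - v k z => qh qP /andP[_ bC].
  have : 0 <= (Cb - b) * (P - q) by rewrite mulr_ge0// subr_ge0.
  have : 0 <= Cb * (q - (P - h)) by rewrite mulr_ge0// subr_ge0.
  lra.
have := ler_wpM2l (ltW s0) H1; have := ler_wpM2l (ltW t0) H2.
move: Bh Hc H3 hE.
rewrite !mulrDr; lra.
Qed.

Lemma subsolution_comparison (lam1 lam2 : R) u v j0 z0 (M0 e : R) :
  is_subsolution lam1 B H u -> is_supersolution lam2 B H v ->
  0 <= M0 -> M0 <= u j0 z0 - v j0 z0 -> 0 < e ->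
  exists k z, M0 - e <= u k z - v k z /\ lam1 * u k z - lam2 * v k z <= e.
Proof.
move=> sub super M00 M0le e0.
have h2 : 0 < (2^-1 : R) < 1 by apply/andP; split; lra.
have M0le' : M0 <= (1 - 2^-1) * u j0 z0 + 2^-1 * u j0 z0 - v j0 z0 by lra.
have [k [z [h1 h3]]] := convex_comparison h2 sub sub super M00 M0le' e0.
by exists k, z; split; lra.
Qed.

Lemma small_slack (lam D : R) : 0 < lam -> 0 < D ->
  exists2 e, 0 < e & e + e / lam < D.
Proof.
move=> lam0 D0; exists (D * lam / ((lam + 1) *+ 2)).
  by rewrite !divr_gt0 ?mulr_gt0// mulrn_wgt0// addr_gt0.
have l1 : 0 < lam + 1 by rewrite addr_gt0.
have -> : D * lam / ((lam + 1) *+ 2) + D * lam / ((lam + 1) *+ 2) / lam = D / 2.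
  by rewrite -(mulr_natr (lam + 1)); field; rewrite !lt0r_neq0.
lra.
Qed.

(** Shifting [u0] by the constants [M] and [- M] gives a supersolution and a
    subsolution of the discounted system, because [u0 + M] and [u0 - M] have a
    sign; so [u] stays within [M] of [u0], uniformly in [lam]. *)
Lemma solution_bound (lam M : R) u u0 : 0 < lam ->
  is_solution 0 B H u0 -> is_solution lam B H u ->
  (forall i x, `|u0 i x| <= M) -> forall i x, `|u i x| <= M *+ 2.
Proof.
move=> lam0 [sub0 super0] [sub super] u0M i x.
have M0 : 0 <= M by apply: le_trans (u0M i x).
have lower : u0 i x - u i x <= M.
  rewrite leNgt; apply/negP => lt.
  have [e e0 eD] := small_slack lam0 (etrans (subr_gt0 _ _) lt).
  have [k [z [h1 h2]]] := subsolution_comparison sub0 super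
    (le_trans M0 (ltW lt)) (lexx _) e0.
  have : - u k z <= e / lam by rewrite ler_pdivlMr//; lra.
  have := u0M k z; rewrite ler_norml => /andP[_ ?]; lra.
have upper : u i x - u0 i x <= M.
  rewrite leNgt; apply/negP => lt.
  have [e e0 eD] := small_slack lam0 (etrans (subr_gt0 _ _) lt).
  have [k [z [h1 h2]]] := subsolution_comparison sub super0
    (le_trans M0 (ltW lt)) (lexx _) e0.
  have : u k z <= e / lam by rewrite ler_pdivlMr//; lra.
  have := u0M k z; rewrite ler_norml => /andP[? _]; lra.
by have := u0M i x; rewrite !ler_norml => /andP[? ?]; lra.
Qed.

(** The heart of the proof. For [t = lam / mu] the convex combination
    [(1 - t) * w + t * v1] satisfies the undiscounted inequality with right-hand
    side [- lam * v1], and by the assumed ordering [v1] is at least this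
    combination minus [(1 - t) * d]. The combination lowered by [(1 - t) * d] is
    therefore a subsolution for the discount [lam], and it lies below [v2];
    since [v1 >= w - d], so does [w - d]. *)
Lemma subsolution_le_propagates (lam mu d : R) w v1 v2 : 0 < lam -> lam < mu -> 0 <= d ->
  is_subsolution 0 B H w -> is_subsolution mu B H v1 -> is_supersolution lam B H v2 ->
  (forall i x, w i x <= v1 i x + d) -> forall i x, w i x <= v2 i x + d.
Proof.
move=> lam0 lammu d0 subw sub1 super2 wv1 i x.
have mu0 : 0 < mu by exact: lt_trans lammu.
pose t := lam / mu.
have t0 : 0 < t by rewrite divr_gt0.
have t1 : t < 1 by rewrite ltr_pdivrMr// mul1r.
have s0 : 0 <= 1 - t by rewrite subr_ge0 ltW.
have tmu : t * mu = lam by rewrite /t divfK// lt0r_neq0.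
suff : (1 - t) * w i x + t * v1 i x - v2 i x <= (1 - t) * d.
  by have := ler_wpM2l (ltW t0) (wv1 i x); lra.
rewrite leNgt; apply/negP => lt.
have [e e0 eD] := small_slack lam0 (etrans (subr_gt0 _ _) lt).
have [|k [z [h1 h2]]] := convex_comparison _ subw sub1 super2
    (le_trans (mulr_ge0 s0 d0) (ltW lt)) (lexx _) e0; first by rewrite t0.
have : v1 k z - v2 k z <= e / lam.
  rewrite ler_pdivlMr//; move: h2.
  by rewrite [t * (mu * _)]mulrA tmu mul0r mulr0; lra.
have := ler_wpM2l s0 (wv1 k z); lra.
Qed.

Lemma coupling_bound : exists2 C, 0 <= C & forall u (M : R), (forall j x, `|u j x| <= M) ->
  forall i x, `|apply_coupling B u i x| <= C * M.
Proof.
have [C C0 BC] := torus_bounded_family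
  (fun ij : 'I_m * 'I_m => B_continuous ij.1 ij.2).
exists (m%:R * C) => [|u M uM i x]; first by rewrite mulr_ge0.
rewrite (le_trans (ler_norm_sum _ _ _))// -mulrA.
rewrite -[m in m%:R]card_ord mulr_natl -sumr_const; apply: ler_sum => j _.
by rewrite normrM ler_pM// (BC (i, j) x).
Qed.

Lemma subsolution_lipschitz (M : R) : exists K, forall lam u, 0 < lam -> lam <= 1 ->
  is_subsolution lam B H u -> (forall i x, `|u i x| <= M) ->
  forall i x y, `|u i x - u i y| <= K * `|x - y|.
Proof.
have [Cb Cb0 HCb] := coupling_bound.
have [K K0 HK] := subsolution_gradient_bound (M + Cb * M).
exists (lipschitz_const n M K) => lam u lam0 lam1 sub uM i.
apply: lipschitz_of_gradient_bound => //; first by case: sub.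
move=> psi x; apply: (HK lam u sub) => {}i {}x.
rewrite (le_trans (ler_normD _ _))// lerD ?HCb// normrM (gtr0_norm lam0).
by rewrite (le_trans _ (uM i x))// ler_piMl.
Qed.

(** Stability under uniform limits with vanishing discount. The sign [s] treats
    subsolutions ([s = 1]) and supersolutions ([s = -1]) together. *)
Lemma viscosity_stability (s : R) w : s ^+ 2 = 1 -> (forall i, torus_continuous (w i)) ->
  (forall e, 0 < e -> exists lam u, [/\ 0 < lam < e, forall i, torus_continuous (u i),
    forall i psi x, torus_C1 psi ->
      (forall y, s * (u i y - psi y) <= s * (u i x - psi x)) ->
      s * (lam * u i x + apply_coupling B u i x + H i x (grad psi x)) <= 0 &
    forall i x, `|u i x - w i x| <= e]) ->
  forall i psi x, torus_C1 psi ->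
    (forall y, s * (w i y - psi y) <= s * (w i x - psi x)) ->
    s * (apply_coupling B w i x + H i x (grad psi x)) <= 0.
Proof.
move=> s2 cw approx i psi x0 Cpsi xmax.
have s1 : `|s| = 1.
  by apply/eqP; rewrite -sqrp_eq1// real_normK ?num_real// s2.
have [Cb Cb0 HCb] := coupling_bound.
have [Mw Mw0 wM] := torus_bounded_family cw.
have Cpert : torus_C1 (fun y => psi y + s * gap x0 y).
  by apply: torus_C1D => //; exact: torus_C1Z (gap_C1 x0).
have [ppert dpert cpert] := Cpert.
pose F (x _ : 'rV[R]_n) := 0 * w i x + apply_coupling B w i x +
  H i x (grad (fun y => psi y + s * gap x0 y) x).
have cF : continuous (fun z : 'rV[R]_n * 'rV[R]_n => F z.1 z.2).
  have cid : continuous (fun x : 'rV[R]_n => x) by move=> x; exact: cvg_id.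
  apply: (@continuous_compT _ _ _ fst (fun x => F x 0)); first exact: continuous_fst.
  exact: (continuous_compT (continuous_pair cid cpert)
    (@system_lhs_continuous 0 w i cw)).
have pF p : Zperiodic (F^~ p).
  move=> z x; rewrite /F (zeroth_order_continuous 0 i cw).1 H_periodic.
  by rewrite (grad_periodic ppert).
have Fx0 : F x0 0 = apply_coupling B w i x0 + H i x0 (grad psi x0).
  rewrite /F mul0r add0r gradD; [|by case: Cpsi|].
    by rewrite gradZ ?grad_gapxx ?scaler0 ?addr0//; exact: gap_differentiable.
  by case: (torus_C1Z s (gap_C1 x0)) => _ + _; exact.
rewrite -Fx0 leNgt; apply/negP; set A := s * _ => A0.
have A20 : 0 < A / 2 by rewrite divr_gt0.
have [d d0 dF] := torus_modulus (@compact_set1 _ (0 : 'rV[R]_n)) cF pF A20.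
pose e := Num.min 1 (Num.min (d / 3) (A / 2 / (Mw + 1 + Cb + 1))).
have c0 : 0 < Mw + 1 + Cb + 1 by move: Mw0 Cb0; lra.
have e0 : 0 < e by rewrite !lt_min ltr01 !divr_gt0.
have [e1 ed eA] : [/\ e <= 1, e *+ 2 < d & e * (Mw + 1 + Cb + 1) <= A / 2].
  rewrite /e; split; first by rewrite ge_min lexx.
    rewrite (@le_lt_trans _ _ (d / 3 *+ 2))//; last by lra.
    by rewrite lerMn2r /= !ge_min lexx orbT.
  by rewrite -ler_pdivlMr// !ge_min lexx !orbT.
clearbody e.
have [lam [u [/andP[lam0 lame] cu tu uw]]] := approx e e0.
have [|||y|x [gx0x umax]] := @perturbed_max R n (fun y => s * w i y)
  (fun y => s * u i y) (fun y => s * psi y) x0 e.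
- exact: torus_C1Z.
- split; first by move=> z y; rewrite (cu i).1.
  move=> y; have Fy : Filter (nbhs y) := nbhs_filter y.
  by apply: cvgM; [exact: cvg_cst|exact: ((cu i).2 y)].
- by move=> y; rewrite -!mulrBr.
- by rewrite -mulrBr normrM s1 mul1r.
have sE y : s * (u i y - (psi y + s * gap x0 y)) = s * u i y - (s * psi y + gap x0 y).
  by rewrite mulrBr mulrDr [s * (s * _)]mulrA -expr2 s2 mul1r.
have test : s * (lam * u i x + apply_coupling B u i x +
    H i x (grad (fun y => psi y + s * gap x0 y) x)) <= 0.
  by apply: tu => // y; rewrite !sE.
have near_coupling : `|apply_coupling B u i x - apply_coupling B w i x| <= Cb * e.
  rewrite -sumrB (eq_bigr (fun j => B x i j * (u j x - w j x))); last first.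
    by move=> j _; rewrite mulrBr.
  by apply: (HCb (fun j y => u j y - w j y)).
have lamu : `|lam * u i x| <= e * (Mw + 1).
  rewrite normrM (gtr0_norm lam0) ler_pM ?(ltW lam0) ?(ltW lame)//.
  rewrite -[u i x](subrKC (w i x)) (le_trans (ler_normD _ _))// lerD//.
  exact: le_trans (uw i x) e1.
have near0 : `|s * F x 0 - A| < A / 2.
  by rewrite -mulrBr normrM s1 mul1r (dF x x0 (le_lt_trans gx0x ed)).
have far : `|s * (F x 0 - (lam * u i x + apply_coupling B u i x +
    H i x (grad (fun y => psi y + s * gap x0 y) x)))| <= A / 2.
  rewrite normrM s1 mul1r /F.
  rewrite (_ : _ - _ = - (apply_coupling B u i x - apply_coupling B w i x)
    - lam * u i x); last by ring.
  rewrite (le_trans (ler_normB _ _))// normrN.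
  rewrite (le_trans (lerD near_coupling lamu))// (le_trans _ eA)//.
  have -> : e * (Mw + 1 + Cb + 1) = Cb * e + e * (Mw + 1) + e by ring.
  by rewrite lerDl ltW.
move: far near0 test; rewrite mulrBr ler_norml ltr_norml.
clearbody A => /andP[? ?] /andP[? ?] ?; lra.
Qed.


Lemma solution_of_uniform_limit w : (forall i, torus_continuous (w i)) ->
  (forall e, 0 < e -> exists lam u, [/\ 0 < lam < e, is_solution lam B H u &
    forall i x, `|u i x - w i x| <= e]) ->
  is_solution 0 B H w.
Proof.
move=> cw approx; split; split=> // i psi x Cpsi xmax.
  have := @viscosity_stability 1 w (expr1n _ _) cw _ i psi x Cpsi.
  rewrite mul0r add0r !mul1r; apply; last by move=> y; rewrite !mul1r.
  move=> e /approx[lam [u [lame [[cu su] _] uw]]]; exists lam, u; split => // j phi y C h.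
  by rewrite mul1r; apply: su => // t; have := h t; rewrite !mul1r.
have := @viscosity_stability (-1) w (etrans (sqrrN 1) (expr1n _ 2)) cw _ i psi x Cpsi.
rewrite mul0r add0r !mulN1r oppr_le0; apply; last by move=> y; rewrite !mulN1r lerN2.
move=> e /approx[lam [u [lame [_ [cu su]] uw]]]; exists lam, u; split => // j phi y C h.
by rewrite mulN1r oppr_le0; apply: su => // t; have := h t; rewrite !mulN1r lerN2.
Qed.

Variables (v_0 : 'I_m -> 'rV[R]_n -> R) (v : R -> 'I_m -> 'rV[R]_n -> R).
Hypotheses (v_0_solution : is_solution 0 B H v_0)
  (v_solution : forall lam, 0 < lam -> is_solution lam B H (v lam)).

Let uniform_limit (U : set_system R) (w : 'I_m -> 'rV[R]_n -> R) :=
  forall e, 0 < e -> \forall lam \near U, forall i x, `|v lam i x - w i x| <= e.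

Lemma ultrafilter_limit_exists (U : set_system R) : UltraFilter U -> 0^'+ `<=` U ->
  exists w, [/\ forall i, torus_lipschitz (w i), is_solution 0 B H w & uniform_limit U w].
Proof.
move=> UU U0.
have [M _ v0M] := torus_bounded_family v_0_solution.1.1.
have [K HK] := subsolution_lipschitz (M *+ 2).
have pos : \forall lam \near U, 0 < lam by apply: U0; exact: nbhs_right_gt.
have small e : 0 < e -> \forall lam \near U, lam < e.
  by move=> e0; apply: U0; exact: nbhs_right_lt.
have bound lam : 0 < lam -> forall i x, `|v lam i x| <= M *+ 2.
  by move=> lam0; exact: solution_bound lam0 v_0_solution (v_solution lam0) v0M.
have ex i : exists w, [/\ Zperiodic w, forall x y, `|w x - w y| <= K * `|x - y| &
    forall e, 0 < e -> \forall lam \near U, forall x, `|v lam i x - w x| <= e].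
  apply: (@equilipschitz_ultra_limit _ _ _ _ _ (fun lam => v lam i) (M *+ 2)).
  - by apply: filterS pos => lam lam0; exact: ((v_solution lam0).1.1 i).1.
  - by apply: filterS pos => lam lam0; exact: bound.
  - apply: filterS (filterI pos (small 1 ltr01)) => lam [lam0 lam1].
    exact: (HK lam (v lam) lam0 (ltW lam1) (v_solution lam0).1 (bound lam lam0) i).
have [w wP] := choice ex.
have lw i : torus_lipschitz (w i).
  by have [pw wK _] := wP i; exact: equilipschitz_torus_lipschitz wK.
have uw : uniform_limit U w.
  move=> e e0; apply: filter_forall => i.
  by have [_ _] := wP i; apply.
exists w; split => //; apply: solution_of_uniform_limit => [i|e e0].
  exact: torus_lipschitz_continuous.
have [lam [[lam0 lame] wlam]] := filter_ex (filterI (filterI pos (small e e0)) (uw e e0)).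
by exists lam, (v lam); split => //; [rewrite lam0|exact: v_solution].
Qed.

(** Once [w1] is below [v mu + e], it is below [v lam + e] for every smaller
    [lam], hence below every other limit. *)
Lemma ultrafilter_limit_le (U1 U2 : set_system R) w1 w2 :
  UltraFilter U1 -> 0^'+ `<=` U1 -> UltraFilter U2 -> 0^'+ `<=` U2 ->
  is_solution 0 B H w1 -> uniform_limit U1 w1 -> uniform_limit U2 w2 ->
  forall i x, w1 i x <= w2 i x.
Proof.
move=> UU1 U10 UU2 U20 sol1 lim1 lim2 i x; apply/ler_addgt0Pr => e e0.
have e20 : 0 < e / 2 by rewrite divr_gt0.
have pos1 : \forall mu \near U1, 0 < mu by apply: U10; exact: nbhs_right_gt.
have pos2 : \forall lam \near U2, 0 < lam by apply: U20; exact: nbhs_right_gt.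
have [mu [mu0 wmu]] := filter_ex (filterI pos1 (lim1 _ e20)).
have small : \forall lam \near U2, lam < mu by apply: U20; exact: nbhs_right_lt.
have [lam [[lam0 lammu] wlam]] := filter_ex (filterI (filterI pos2 small) (lim2 _ e20)).
have below j y : w1 j y <= v mu j y + e / 2.
  by have := wmu j y; rewrite ler_norml => /andP[? ?]; lra.
have := subsolution_le_propagates lam0 lammu (ltW e20) sol1.1 (v_solution mu0).1
  (v_solution lam0).2 below i x.
by have := wlam i x; rewrite ler_norml => /andP[? ?] ?; lra.
Qed.

Lemma vanishing_discount_limit : exists w, [/\ forall i, torus_lipschitz (w i),
  is_solution 0 B H w & uniform_limit 0^'+ w].
Proof.
have [U [UU U0]] := ultraFilterLemma (at_right_proper_filter (0 : R)).
have [w [lw sw uw]] := ultrafilter_limit_exists UU U0.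
exists w; split => // e e0.
apply: ultrafilters_near => U' UU' U'0.
have [w' [_ sw' uw']] := ultrafilter_limit_exists UU' U'0.
have ww' i x : w' i x = w i x.
  by apply/le_anti; rewrite (ultrafilter_limit_le UU' U'0 UU U0 sw' uw' uw)
    (ultrafilter_limit_le UU U0 UU' U'0 sw uw uw').
by apply: filterS (uw' e e0) => lam h i x; rewrite -ww'.
Qed.

End weakly_coupled_system.

(** * Convergence of the discounted solutions *)

Theorem theorem9 (R : realType) (m n : nat) (m_gt0 : (0 < m)%N) (n_gt0 : (0 < n)%N)
    (Xi : metricType R)
    (Xi_neq0 : [set: Xi] !=set0) (Xi_compact : compact [set: Xi])
    (g : 'I_m -> 'rV[R]_n -> Xi -> 'rV[R]_n) (L : 'I_m -> 'rV[R]_n -> Xi -> R)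
    (g_periodic : forall i, Zperiodic (g i))
    (g_continuous : forall i, continuous (fun z : 'rV[R]_n * Xi => g i z.1 z.2))
    (L_periodic : forall i, Zperiodic (L i))
    (L_continuous : forall i, continuous (fun z : 'rV[R]_n * Xi => L i z.1 z.2))
    (B : 'rV[R]_n -> 'M[R]_m)
    (B_continuous : forall i j, torus_continuous (fun x => B x i j))
    (H_coercive : coercive (hamiltonian g L))
    (B_monotone : forall x, monotone_matrix (B x))
    (v_0 : 'I_m -> 'rV[R]_n -> R)
    (v_0_lipschitz : forall i, torus_lipschitz (v_0 i))
    (v_0_solution : is_solution 0 B (hamiltonian g L) v_0)
    (v : R -> 'I_m -> 'rV[R]_n -> R)
    (v_solution : forall lam : R, 0 < lam ->
      is_solution lam B (hamiltonian g L) (v lam)) :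
  exists v0 : 'I_m -> 'rV[R]_n -> R,
    [/\ forall i, torus_lipschitz (v0 i),
        is_solution 0 B (hamiltonian g L) v0 &
        forall i, {uniform, (fun lam => v lam i) @ 0^'+ --> v0 i}].
Proof.
have [w [lw sw uw]] := vanishing_discount_limit B_continuous B_monotone
  (hamiltonian_periodic g_periodic L_periodic)
  (hamiltonian_continuous Xi_neq0 Xi_compact g_continuous L_continuous)
  (hamiltonian_convex Xi_neq0 Xi_compact g_continuous L_continuous)
  (hamiltonian_sublevel_bounded Xi_neq0 Xi_compact g_periodic g_continuous
     L_periodic L_continuous H_coercive)
  v_0_solution v_solution.
exists w; split => // i P /uniform_nbhs[E [entE EP]].
move: entE; rewrite -entourage_ballE => -[e /= e0 eE].
have e20 : 0 < e / 2 by rewrite divr_gt0.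
apply: filterS (uw (e / 2) e20) => lam near_w; apply: EP => x _; apply: eE => /=.
rewrite /ball /= distrC (le_lt_trans (near_w i x))//.
by rewrite ltr_pdivrMr// ltr_pMr// ltr1n.
Qed.
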